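(* Let $\pi\in S_N$ be a permutation such that $Y_\pi$ is toric, $L(\pi)$ is connected, and at least three boxes of $\operatorname{Ess}(\pi)$ lie in $L(\pi)$. Let $G^\pi\subseteq K_{m,n}$ be the associated connected bipartite graph with parts $U_1,U_2$, $|U_1|=m$, $|U_2|=n$. Write $A=U_1\setminus\{i\}$, $A'=U_1\setminus\{i'\}$ (with $i\neq i'$ in $U_1$) and $B=U_2\setminus\{j\}$ ($j\in U_2$) for one-sided first independent sets, and $C=C_1\sqcup C_2$, $C'=C_1'\sqcup C_2'$ (with $C_1,C_1'\subseteq U_1$ and $C_2,C_2'\subseteq U_2$) for two-sided first independent sets of $G^\pi$. Then: (1) For any $A,B\in\mathcal{I}^{(1)}_{G^\pi}$, $(A,B)\in\mathcal{I}^{(2)}_{G^\pi}$. (2) For any two distinct $C,C'\in\mathcal{I}^{(1)}_{G^\pi}$, $(C,C')\in\mathcal{I}^{(2)}_{G^\pi}$. (3) $(A,A')\notin\mathcal{I}^{(2)}_{G^\pi}$ if and only if there exists a two-sided first independent set of the form $(U_1\setminus\{i,i'\})\sqcup C_2$, where $C_2\subsetneq U_2$ is some vertex set with $|C_2|\le n-2$. (4) $(A,C)\notin\mathcal{I}^{(2)}_{G^\pi}$ if and only if $C_1=\{i\}$ or there exists a two-sided $C'\in\mathcal{I}^{(1)}_{G^\pi}$ with $C'_1\subseteq C_1$ and $C_1\setminus C'_1=\{i\}$.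
   Context: Matrix Schubert varieties. Identify $\pi\in S_N$ with the $N\times N$ permutation matrix with entry $1$ at $(i,j)$ iff $\pi(j)=i$. Let $B_-$, $B_+$ be the groups of invertible lower, resp. upper, triangular $N\times N$ matrices; $\overline{X_\pi}=\overline{B_-\pi B_+}\subseteq\mathbb{C}^{N\times N}$ (Zariski closure). The Rothe diagram is $D(\pi)=\{(\pi(j),i): i<j,\ \pi(i)>\pi(j)\}$, whose elements are called boxes (row index, column index). $\operatorname{dom}(\pi)$ is the connected component of $D(\pi)$ containing $(1,1)$ (empty if $(1,1)\notin D(\pi)$), boxes being connected through common sides. The essential set $\operatorname{Ess}(\pi)$ consists of the south-east corners of the connected components of $D(\pi)$, i.e. boxes $(a,b)\in D(\pi)$ with $(a+1,b),(a,b+1)\notin D(\pi)$. $\operatorname{NW}(\pi)$ is the set of boxes $(a,b)$ for which there is $(c,d)\in D(\pi)$ with $a\le c$, $b\le d$. Put $L(\pi)=\operatorname{NW}(\pi)\setminus\operatorname{dom}(\pi)$. $Y_\pi$ is the projection of $\overline{X_\pi}$ to the coordinates indexed by $L(\pi)$. $(\mathbb{C}^* )^{2N}$ (pairs of invertible diagonal matrices) acts on $Y_\pi$ by $\mathcal{M}\mapsto D_1\mathcal{M}D_2^{-1}$; let $T$ be the quotient by the subgroup acting trivially. $Y_\pi$ is called toric if $\dim T=\dim Y_\pi$. Graph. $G^\pi$ is the bipartite graph with parts $U_1$ (the rows meeting $L(\pi)$) and $U_2$ (the columns meeting $L(\pi)$), with an edge joining $a\in U_1$ and $b\in U_2$ iff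 $(a,b)\in L(\pi)$. Independent sets of a connected bipartite graph $G$ with parts $U_1,U_2$. A nonempty set of vertices is independent if it contains no two adjacent vertices; an independent set $A\subsetneq V(G)$ is maximal if no other independent set contains it. An independent set is one-sided if it is contained in $U_1$ or in $U_2$; $A=A_1\sqcup A_2$ is two-sided if $\emptyset\ne A_1\subsetneq U_1$ and $\emptyset\ne A_2\subsetneq U_2$. $N(A)$ is the set of vertices adjacent to some vertex of $A$ and $G[A]$ is the induced subgraph. The associated bipartite subgraph $G\{A\}$ is the spanning subgraph of $G$ whose edges are those of $G[A\sqcup N(A)]\sqcup G[(U_i\setminus A)\sqcup(U_j\setminus N(A))]$ if $A\subseteq U_i$ is one-sided ($\{i,j\}=\{1,2\}$), and those of $G[A_1\sqcup N(A_1)]\sqcup G[A_2\sqcup N(A_2)]$ if $A=A_1\sqcup A_2$ is two-sided. The set $\mathcal{I}^{(1)}_G$ of first independent sets consists of those two-sided maximal independent sets and those one-sided independent sets of the form $U_i\setminus\{u\}$ (with $u\in U_i$) whose associated bipartite subgraph has exactly two connected components (isolated vertices count as components). Edge cone and faces. Let $e_i$ ($i\in U_1$), $f_j$ ($j\in U_2$) be the canonical basis of $\mathbb{Z}^{m+n}$ and $e^i,f^j$ the dual basis; $N=\mathbb{Z}^{m+n}/\langle\sum_i e_i-\sum_j f_j\rangle$ and $M=\mathbb{Z}^{m+n}\cap\langle\sum_i e_i-\sum_j f_j\rangle^{\perp}$ are dual lattices. $\sigma_G^\vee=\operatorname{Cone}(e^i+f^j:(i,j)\in E(G))\subseteq M_{\mathbb{Q}}$,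 and the edge cone $\sigma_G\subseteq N_{\mathbb{Q}}$ is its dual; $\sigma_\pi:=\sigma_{G^\pi}$. For an independent set $A$, $\mathcal{H}_A=\{x\in M_{\mathbb{Q}}:\sum_{v\in A}x_v=\sum_{v\in N(A)}x_v\}$. It is known that $A\mapsto\Pi(A):=$ the primitive generator of the ray of $\sigma_G$ dual to the facet $\mathcal{H}_{A_i}\cap\sigma_G^\vee$ (for $i$ with $A_i=A\cap U_i\neq\emptyset$) is a bijection from $\mathcal{I}^{(1)}_G$ to the extremal ray generators of $\sigma_G$. $\mathcal{I}^{(d)}_{G}$ denotes the set of $d$-tuples of first independent sets whose images under $\Pi$ form a $d$-dimensional face of $\sigma_G$; equivalently, for a set $S$ of $d$ first independent sets, the spanning subgraph $\bigcap_{A\in S}G\{A\}$ has $d+1$ connected components. *)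

(* Defs.v *)
From HB Require Import structures.
From mathcomp Require Import all_boot all_order all_algebra perm.
From mathcomp Require Import boolp classical_sets reals complex.
From mathcomp Require Import mpoly.

Set Implicit Arguments.
Unset Strict Implicit.
Unset Printing Implicit Defensive.

Import Order.TTheory GRing.Theory Num.Theory.
Local Open Scope ring_scope.

(* [cl] is the family of closed sets of a topological space whose points lie in
   [X]; the points need not exhaust [X]. *)
Section KrullDimension.
Variables (X : Type) (cl : set (set X)).
Local Open Scope classical_set_scope.

Definition irreducible_closed (Z : set X) : Prop :=
  [/\ cl Z, Z !=set0
    & forall Z1 Z2, cl Z1 -> cl Z2 ->
        Z `<=` Z1 `|` Z2 -> Z `<=` Z1 \/ Z `<=` Z2].

(* Z_0 < Z_1 < ... < Z_d *)
Definition irreducible_chain (d : nat) (Z : nat -> set X) : Prop :=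
  (forall k, (k <= d)%N -> irreducible_closed (Z k)) /\
  (forall k, (k < d)%N -> Z k `<=` Z k.+1 /\ Z k <> Z k.+1).

Definition krull_dim_is (d : nat) : Prop :=
  (exists Z, irreducible_chain d Z) /\
  ~ (exists Z, irreducible_chain d.+1 Z).

End KrullDimension.

Section Zariski.
Variables (F : fieldType) (I : finType).
Local Open Scope classical_set_scope.

Definition eval_at (p : {mpoly F[#|I|]}) (x : {ffun I -> F}) : F :=
  p.@[fun k => x (enum_val k)].

Definition zeros (S : set {mpoly F[#|I|]}) : set {ffun I -> F} :=
  [set x | forall p, S p -> eval_at p x = 0].

Definition zariski_closed (Z : set {ffun I -> F}) : Prop :=
  exists S, Z = zeros S.

Definition zariski_closure (X : set {ffun I -> F}) : set {ffun I -> F} :=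
  \bigcap_(Z in [set Z | zariski_closed Z /\ X `<=` Z]) Z.

(* The closed sets of [X] for the topology induced by that of F^I. *)
Definition closed_in (X : set {ffun I -> F}) : set (set {ffun I -> F}) :=
  [set Z | exists2 W, zariski_closed W & Z = X `&` W].

End Zariski.

(* Boxes are (row, column), numbered from 0. *)
Section Diagrams.
Variable N : nat.
Local Notation box := ('I_N * 'I_N)%type.

Definition adjacent_boxes (x y : box) : bool :=
  ((x.1 == y.1) && ((x.2.+1 == y.2 :> nat) || (y.2.+1 == x.2 :> nat))) ||
  ((x.2 == y.2) && ((x.1.+1 == y.1 :> nat) || (y.1.+1 == x.1 :> nat))).

Definition side_connect (S : {set box}) : rel box :=
  connect (fun x y => [&& x \in S, y \in S & adjacent_boxes x y]).

Definition side_connected (S : {set box}) : Prop :=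
  {in S &, forall x y, side_connect S x y}.

Variable pi : 'S_N.

Definition rothe : {set box} :=
  [set (pi ij.2, ij.1) | ij : box & (ij.1 < ij.2)%N && (pi ij.2 < pi ij.1)%N].

Definition dominant : {set box} :=
  [set y : box in rothe | [exists x : box,
    [&& x \in rothe, x.1 == 0 :> nat, x.2 == 0 :> nat
      & side_connect rothe x y]]].

Definition essential : {set box} :=
  [set x : box in rothe | [forall y : box, (y \in rothe) ==>
    ~~ ((y.1 == x.1.+1 :> nat) && (y.2 == x.2)) &&
    ~~ ((y.1 == x.1) && (y.2 == x.2.+1 :> nat))]].

Definition northwest : {set box} :=
  [set x : box | [exists y : box,
    [&& y \in rothe, (x.1 <= y.1)%N & (x.2 <= y.2)%N]]].

Definition Lset : {set box} := northwest :\: dominant.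

Definition Lrow : finType := {a : 'I_N | [exists b, (a, b) \in Lset]}.
Definition Lcol : finType := {b : 'I_N | [exists a, (a, b) \in Lset]}.

(* The graph G^pi: [Lrow] and [Lcol] are its parts U_1 and U_2. *)
Definition Lgraph (a : Lrow) (b : Lcol) : bool := (val a, val b) \in Lset.

End Diagrams.

Section MatrixSchubert.
Variables (F : fieldType) (N : nat) (pi : 'S_N).
Local Open Scope classical_set_scope.

Definition schubert_perm_mx : 'M[F]_N := \matrix_(i, j) (pi j == i)%:R.

Definition mx_point (M : 'M[F]_N) : {ffun 'I_N * 'I_N -> F} :=
  [ffun x => M x.1 x.2].

(* [is_trig_mx] means lower triangular. *)
Definition schubert_cell : set {ffun 'I_N * 'I_N -> F} :=
  [set x | exists P Q : 'M[F]_N,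
     [/\ is_trig_mx P, P \in unitmx, is_trig_mx Q^T, Q \in unitmx
       & x = mx_point (P *m schubert_perm_mx *m Q)]].

Definition matrix_schubert : set {ffun 'I_N * 'I_N -> F} :=
  zariski_closure schubert_cell.

Definition Lbox : finType := {x : 'I_N * 'I_N | x \in Lset pi}.

Definition Yvar : set {ffun Lbox -> F} :=
  [set [ffun x : Lbox => M (val x)] | M in matrix_schubert].

(* (D_1, D_2) is given by its diagonal entries [g (inl a)] and [g (inr b)]. *)
Definition torus : set {ffun 'I_N + 'I_N -> F} :=
  [set g | forall k, g k != 0].

Definition torus_mul (g h : {ffun 'I_N + 'I_N -> F}) :
  {ffun 'I_N + 'I_N -> F} := [ffun k => g k * h k].

Definition torus_act (g : {ffun 'I_N + 'I_N -> F}) (y : {ffun Lbox -> F}) :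
    {ffun Lbox -> F} :=
  [ffun x : Lbox => g (inl (val x).1) * y x * (g (inr (val x).2))^-1].

Definition trivially_acting : set {ffun 'I_N + 'I_N -> F} :=
  [set g | torus g /\ forall y, Yvar y -> torus_act g y = y].

Definition torus_coset (g : {ffun 'I_N + 'I_N -> F}) :
    set {ffun 'I_N + 'I_N -> F} :=
  [set torus_mul g k | k in trivially_acting].

(* The closed sets of the quotient T, whose points are the cosets, for the
   quotient topology. *)
Definition quotient_torus_closed : set (set (set {ffun 'I_N + 'I_N -> F})) :=
  [set Z | Z `<=` [set torus_coset g | g in torus] /\
     closed_in torus [set g | torus g /\ Z (torus_coset g)]].

Definition toric : Prop :=
  exists d, krull_dim_is quotient_torus_closed d /\
            krull_dim_is (closed_in Yvar) d.

End MatrixSchubert.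

Section Bipartite.
Variables (U1 U2 : finType) (E : U1 -> U2 -> bool).
Local Notation V := (U1 + U2)%type.

Definition adj : rel V := fun u v =>
  match u, v with
  | inl i, inr j => E i j
  | inr j, inl i => E i j
  | _, _ => false
  end.

(* [part true] is U_1 and [part false] is U_2. *)
Definition part (s : bool) : {set V} :=
  [set v | (if v is inl _ then true else false) == s].

Definition nbhd (A : {set V}) : {set V} := [set v | [exists u in A, adj u v]].

Definition independent (A : {set V}) : bool :=
  (A != finset.set0) && [forall u in A, forall v in A, ~~ adj u v].

Definition max_independent (A : {set V}) : bool :=
  [&& independent A, A \proper [set: V]
    & [forall B : {set V}, independent B && (A \subset B) ==> (B == A)]].

Definition two_sided (A : {set V}) : bool :=
  [forall s, (A :&: part s != finset.set0) && (A :&: part s \proper part s)].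

Definition ncomponents (e : rel V) : nat := n_comp e [set: V].

(* The spanning subgraph with the edges of G[S] and of G[S']. *)
Definition induced2 (S S' : {set V}) : rel V := fun u v =>
  adj u v && ((u \in S) && (v \in S) || (u \in S') && (v \in S')).

Definition assoc_subgraph (A : {set V}) : rel V :=
  let one_sided s :=
    induced2 (A :|: nbhd A) ((part s :\: A) :|: (part (~~ s) :\: nbhd A)) in
  if A \subset part true then one_sided true
  else if A \subset part false then one_sided false
  else induced2 ((A :&: part true) :|: nbhd (A :&: part true))
                ((A :&: part false) :|: nbhd (A :&: part false)).

Definition first_independent (A : {set V}) : bool :=
  [&& independent A,
      two_sided A && max_independent A ||
        [exists s, exists u in part s, A == part s :\ u]
    & ncomponents (assoc_subgraph A) == 2].

Local Notation vec := {ffun V -> rat^o}.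

Definition pairing (x y : vec) : rat := \sum_v x v * y v.

(* sum_i e_i - sum_j f_j *)
Definition line_gen : vec := [ffun v => if v is inl _ then 1 else -1].

(* N_Q and N are quotients of Q^V and Z^V by multiples of [line_gen]. Their
   elements are given by representatives in Q^V, up to the congruence [eqN],
   and sets of elements by the saturated sets of all representatives.
   As [line_gen] has entries 1 and -1, integral representatives that are
   congruent modulo Q [line_gen] are congruent modulo Z [line_gen]. *)
Definition eqN (y z : vec) : Prop := exists c : rat, y = z + c *: line_gen.

Definition lattice (y : vec) : Prop := forall v, y v \is a Num.int.

(* e^i + f^j. These lie in M_Q, hence so does [dual_edge_cone]; [hyperplane] is
   only used inside it. *)
Definition edge_vec (i : U1) (j : U2) : vec :=
  [ffun v => (v == inl i)%:R + (v == inr j)%:R].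

Definition dual_edge_cone : set vec := fun x =>
  exists c : U1 -> U2 -> rat, (forall i j, 0 <= c i j) /\
    x = \sum_i \sum_(j | E i j) c i j *: edge_vec i j.

Definition edge_cone : set vec := fun y =>
  forall x, dual_edge_cone x -> 0 <= pairing x y.

Definition hyperplane (A : {set V}) : set vec := fun x =>
  \sum_(v in A) x v = \sum_(v in nbhd A) x v.

(* The face of [edge_cone] dual to the face [hyperplane A] of
   [dual_edge_cone]. *)
Definition dual_face (A : {set V}) : set vec := fun y =>
  edge_cone y /\
  forall x, dual_edge_cone x -> hyperplane A x -> pairing x y = 0.

(* The multiple [k] = 0 is allowed, so the zero class is not primitive. *)
Definition primitive (p : vec) : Prop :=
  lattice p /\
  forall (k : nat) (q : vec), lattice q -> eqN p (q *+ k) -> k = 1%N.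

Definition cone_spanned (d : nat) (p : 'I_d -> vec) : set vec := fun y =>
  exists c : 'I_d -> rat,
    (forall k, 0 <= c k) /\ eqN y (\sum_k c k *: p k).

(* p represents Pi(A). *)
Definition ray_generator (A : {set V}) (p : vec) : Prop :=
  primitive p /\
  forall s, A :&: part s != finset.set0 ->
    dual_face (A :&: part s) = cone_spanned (fun _ : 'I_1 => p).

Definition is_face (tau : set vec) : Prop :=
  exists2 x, dual_edge_cone x
    & tau = (fun y => edge_cone y /\ pairing x y = 0).

(* dimension, in N_Q, of the span of the classes of the p k *)
Definition span_dim (d : nat) (p : 'I_d -> vec) : nat :=
  (\dim (<<[seq p k | k : 'I_d]>> + <[line_gen]>) - \dim <[line_gen]>)%N.

(* I^(d) *)
Definition independent_face (d : nat) (A : d.-tuple {set V}) : Prop :=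
  (forall k, first_independent (tnth A k)) /\
  exists p : 'I_d -> vec,
    [/\ forall k, ray_generator (tnth A k) (p k),
        is_face (cone_spanned p) & span_dim p = d].

End Bipartite.

Arguments part {U1 U2} s.
Arguments two_sided {U1 U2} A.

(* Main.v *)
Require Import Defs.
From HB Require Import structures.
From mathcomp Require Import all_boot all_order all_algebra perm.
From mathcomp Require Import boolp classical_sets reals complex.
From mathcomp Require Import mpoly ring lra zify.

(* If Y_pi is toric then L = L(pi) is, up to translation, a Ferrers shape whose
   first two rows and first two columns are full, and the four claims are
   statements about the edge cone of a Ferrers graph.

   The dimension of T is at most m + n - 1: along a chain of irreducible closed
   sets, functions vanishing on one set but not on the next one are algebraically
   independent, and T has m + n - 1 coordinates. The dimension of Y_pi is at least
   |L \ D(pi)|: the matrices P pi Q, with the parameters in the triangular matrices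
   P and Q switched on one by one, give a chain of that length. Hence
   |L \ D(pi)| <= m + n - 1. Seen as a bipartite graph on the m rows and n columns,
   L \ D(pi) is connected, so it is a tree. In particular it contains no rectangle,
   which forces L to contain a single one w of pi, with L the part of NW(pi)
   weakly south-east of w and L \ D(pi) the hook of w.

   In the edge cone, U_1 \ {i}, U_2 \ {j} and C correspond to the rays of e_i, f_j
   and the sum of the f_b with b outside C_2 minus the sum of the e_a with a in C_1.
   Two rays span a face iff the edges on which both generators vanish connect
   the graph up to three components; otherwise some f_b lies on the smallest face
   containing both. *)

Set Implicit Arguments.
Unset Strict Implicit.
Unset Printing Implicit Defensive.
Import Order.TTheory GRing.Theory Num.Theory.

(** * The shape of L(pi) *)

(** Toricity is used only through the inequality |L \ D(pi)| <= m + n - 1, and one-sided bounds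
    suffice for it: neither dimension is computed. Characteristic zero enters there, through
    polynomials with infinitely many zeros and through sums of ones being nonzero. Components of
    D(pi) are traded for an order condition: dom(pi) is the set of boxes with no one weakly
    north-west. In the Ferrers graph, the two full rows and two full columns act as hubs: whatever
    row or column is left out, another full one still joins the rest. So a vector vanishing on the
    common tight edges is determined by very few coordinates, and each coefficient is its value on
    an edge where one generator is 1 and the other 0. *)

Section EdgeCount.
Variables (T1 T2 : finType) (F : {set T1 * T2}).

Definition edge_rel : rel (T1 + T2) := adj (fun a b => (a, b) \in F).

Lemma edge_rel_sym : ssrbool.symmetric edge_rel.
Proof. by move=> [a|b] [a'|b']. Qed.

Lemma edge_rel_connect_sym : connect_sym edge_rel.
Proof. exact/sym_connect_sym/edge_rel_sym. Qed.

(** Take a largest [W] containing [v0] with at most one vertex more than it has edges inside.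
    Attaching a neighbour of [W] adds one vertex and at least one edge, so by maximality [W] is a
    union of components and contains [A]. *)
Lemma connected_card (A : {set T1 + T2}) v0 :
  {in A, forall v, connect edge_rel v0 v} -> #|A| <= #|F|.+1.
Proof.
move=> A_conn.
pose inside (W : {set T1 + T2}) := [set f in F | (inl f.1 \in W) && (inr f.2 \in W)].
pose P (W : {set T1 + T2}) := (v0 \in W) && (#|W| <= #|inside W|.+1).
have P0 : P [set v0] by rewrite /P set11 cards1.
case: (@arg_maxnP _ [set v0] P (fun W => #|W|) P0) => W /andP[v0W W_le] W_max.
have W_closed : closed edge_rel (mem W).
  apply: intro_closed; first exact: edge_rel_connect_sym.
  move=> u v uv uW; apply: contraT => vW.
  suff : P (v |: W) by move=> /W_max /=; rewrite /= cardsU1 vW add1n ltnn.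
  rewrite /P inE v0W orbT /= cardsU1 vW add1n.
  apply: leq_trans (_ : (#|inside W|.+2 <= _)); first by rewrite ltnS.
  rewrite ltnS; apply: proper_card; apply/properP; split.
    apply/fintype.subsetP => f; rewrite !inE => /andP[-> /andP[-> ->]].
    by rewrite !orbT.
  case: u v uv uW vW => [a|b] [a'|b'] //= uv uW vW.
    by exists (a, b'); rewrite !inE ?uv /= ?uW ?eqxx ?orbT //= (negPf vW) andbF.
  by exists (a', b); rewrite !inE ?uv /= ?uW ?eqxx ?orbT //= (negPf vW).
apply: leq_trans (_ : #|W| <= _).
  apply/subset_leq_card/fintype.subsetP => v /A_conn/(closed_connect W_closed) <-.
  exact: v0W.
apply: leq_trans W_le _; rewrite ltnS; apply/subset_leq_card/fintype.subsetP => f.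
by rewrite inE => /andP[].
Qed.

End EdgeCount.

(** * Rothe diagrams and the ones of the permutation matrix *)

Section RotheDiagram.
Variables (N : nat) (pi : 'S_N).
Local Notation box := ('I_N * 'I_N)%type.
Local Notation D := (rothe pi).
Local Notation L := (Lset pi).
Local Notation NW := (northwest pi).

Lemma mem_rothe (x : box) :
  (x \in D) = (x.1 < pi x.2) && (x.2 < (pi^-1)%g x.1).
Proof.
apply/imsetP/andP => [[[i j]]|[lt1 lt2]].
  by rewrite inE /= => /andP[ij pji] ->; rewrite /= permK.
exists (x.2, (pi^-1)%g x.1); first by rewrite inE /= permKV lt1 lt2.
by rewrite /= permKV -surjective_pairing.
Qed.

Definition above (x y : box) : bool := (x.1 <= y.1) && (x.2 <= y.2).

Lemma above_refl x : above x x. Proof. by rewrite /above !leqnn. Qed.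

Lemma above_trans x y z : above x y -> above y z -> above x z.
Proof.
move=> /andP[xy1 xy2] /andP[yz1 yz2].
by rewrite /above (leq_trans xy1) // (leq_trans xy2).
Qed.

Definition one (c : 'I_N) : box := (pi c, c).

Lemma northwestP (x : box) : reflect (exists2 y, y \in D & above x y) (x \in NW).
Proof.
rewrite inE; apply: (iffP existsP) => [[y /and3P[yD y1 y2]]|[y yD /andP[y1 y2]]].
  by exists y; rewrite // /above y1.
by exists y; rewrite yD y1.
Qed.

Lemma northwest_above x y : above x y -> y \in NW -> x \in NW.
Proof.
by move=> xy /northwestP[z zD yz]; apply/northwestP; exists z; rewrite // (above_trans xy).
Qed.

Lemma rothe_northwest x : x \in D -> x \in NW.
Proof. by move=> xD; apply/northwestP; exists x; rewrite // above_refl. Qed.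

(** The hook running right and down from a one avoids D(pi). *)
Lemma above_one_rothe c x : x \in D -> above (one c) x ->
  (pi c < x.1) && (c < x.2).
Proof.
rewrite mem_rothe => /andP[x1 x2] /andP[/= c1 c2].
rewrite !ltn_neqAle c1 c2 !andbT; apply/andP; split; apply/negP => /eqP/val_inj e.
  by move: x2; rewrite -e permK ltnNge c2.
by move: x1; rewrite -e ltnNge c1.
Qed.

(** A box of D(pi) weakly south-east of a one is strictly so, hence an adjacent box is still weakly
    south-east of the same one. *)
Lemma side_connect_above_one x y : side_connect D x y ->
  [exists c, above (one c) x] = [exists c, above (one c) y].
Proof.
move=> xy; set P : pred box := fun x => [exists c, above (one c) x].
suff /closed_connect /(_ x y xy) :
  closed (fun x y => [&& x \in D, y \in D & adjacent_boxes x y]) P by [].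
apply: intro_closed.
  apply: sym_connect_sym => u v; rewrite andbCA; congr [&& _, _ & _].
  rewrite /adjacent_boxes [u.1 == _]eq_sym [u.2 == v.2]eq_sym.
  by congr (_ || _); congr (_ && _); rewrite orbC.
move=> u v /and3P[uD _ uv] /existsP[c cu]; apply/existsP; exists c.
have /andP[] := above_one_rothe uD cu; rewrite /above /=.
case/orP: uv => /andP[/eqP uv /orP[] /eqP]; rewrite ?uv; lia.
Qed.

(** The whole rectangle from the corner to [x] lies in D(pi); the path follows the first row and
    then the column of [x]. *)
Lemma not_above_one_dominant x :
  ~~ [exists c, above (one c) x] -> x \in dominant pi.
Proof.
move=> no_one.
have in_D y : above y x -> y \in D.
  move=> yx; rewrite mem_rothe; apply/andP; split; rewrite ltnNge; apply: contraNN no_one => le_y.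
    by apply/existsP; exists y.2; apply: above_trans yx; rewrite /above /= le_y leqnn.
  apply/existsP; exists ((pi^-1)%g y.1); apply: above_trans yx.
  by rewrite /above /= permKV le_y leqnn.
have N0 : 0 < N by apply: leq_ltn_trans (ltn_ord x.1).
pose o := Ordinal N0.
rewrite inE in_D ?above_refl //=; apply/existsP; exists (o, o).
rewrite in_D ?eqxx //=.
have ordE (j : 'I_N) (jN : j < N) : Ordinal jN = j by apply/val_inj.
have row k (kN : k < N) : k <= x.2 -> side_connect D (o, o) (o, Ordinal kN).
  elim: k kN => [|k IH] kN kx.
    by rewrite (_ : Ordinal kN = o); [exact: connect0|exact/val_inj].
  apply: connect_trans (IH (ltnW kN) (ltnW kx)) _; apply: connect1.
  by rewrite !in_D ?/above /= ?kx ?(ltnW kx) // /adjacent_boxes /= !eqxx.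
have col k (kN : k < N) : k <= x.1 -> side_connect D (o, o) (Ordinal kN, x.2).
  elim: k kN => [|k IH] kN kx.
    have := row x.2 (ltn_ord x.2) (leqnn _); rewrite (ordE x.2) (_ : Ordinal kN = o) //.
    exact/val_inj.
  apply: connect_trans (IH (ltnW kN) (ltnW kx)) _; apply: connect1.
  by rewrite !in_D ?/above /= ?kx ?(ltnW kx) ?leqnn // /adjacent_boxes /= !eqxx orbT.
have := col x.1 (ltn_ord x.1) (leqnn _).
by rewrite (ordE x.1) -surjective_pairing.
Qed.

(** Being south-east of a one is constant along paths in D(pi) and fails at the corner when that box
    is in D(pi), so no box of [dominant] has this property. *)
Lemma Lset_above_one x :
  (x \in L) = (x \in NW) && [exists c, above (one c) x].
Proof.
rewrite inE andbC; congr (_ && _); apply/idP/idP => [|x_one].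
  by apply: contraNT => /not_above_one_dominant.
apply/negP; rewrite inE => /andP[_ /existsP[o /and4P[oD /eqP o1 /eqP o2]]].
move=> /side_connect_above_one; rewrite x_one => /existsP[c].
by move=> /(above_one_rothe oD); rewrite o1 ltn0.
Qed.

Lemma one_Lset c : one c \in NW -> one c \in L.
Proof.
by move=> cN; rewrite Lset_above_one cN; apply/existsP; exists c; rewrite above_refl.
Qed.

Lemma Lset_northwest x : x \in L -> x \in NW.
Proof. by rewrite inE => /andP[]. Qed.

Lemma below_one_notin_rothe (c a : 'I_N) : pi c <= a -> (a, c) \notin D.
Proof. by rewrite mem_rothe /= leqNgt => /negPf ->. Qed.

Lemma right_of_one_notin_rothe (c b : 'I_N) : c <= b -> (pi c, b) \notin D.
Proof. by rewrite mem_rothe /= permK leqNgt => /negPf ->; rewrite andbF. Qed.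

Lemma adjacent_boxes_sym : ssrbool.symmetric (@adjacent_boxes N).
Proof.
move=> u v; rewrite /adjacent_boxes [u.1 == _]eq_sym [u.2 == v.2]eq_sym.
by congr (_ || _); congr (_ && _); rewrite orbC.
Qed.

(** A subset of all row and column indices rather than a subtype, since [edge_rel] and the
    coordinates of the torus live on the full index type. *)
Definition Lvertices : {set 'I_N + 'I_N} :=
  [set match v with inl a => inl (val a) | inr b => inr (val b) end
  | v in [set: Lrow pi + Lcol pi]].

Lemma card_Lvertices : #|Lvertices| = #|Lrow pi| + #|Lcol pi|.
Proof.
rewrite card_imset ?cardsT ?card_sum // => -[a|b] [a'|b'] //= [/val_inj ->] //.
Qed.

Lemma Lvertices_row (a b : 'I_N) : (a, b) \in L -> inl a \in Lvertices.
Proof.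
move=> abL; have aL : [exists b, (a, b) \in L] by apply/existsP; exists b.
by apply/imsetP; exists (inl (exist _ a aL)).
Qed.

Lemma Lvertices_col (a b : 'I_N) : (a, b) \in L -> inr b \in Lvertices.
Proof.
move=> abL; have bL : [exists a, (a, b) \in L] by apply/existsP; exists a.
by apply/imsetP; exists (inr (exist _ b bL)).
Qed.

(** * The tree L(pi) \ D(pi) and the resulting Ferrers shape *)

Section Tree.
Hypothesis L_connected : side_connected L.

(** Adjacent boxes share a row or a column, so values propagate along paths of L. The function [g]
    will be the component of a vertex, and later an element of the torus. *)
Lemma Lset_const (T : eqType) (g : 'I_N + 'I_N -> T) :
  (forall x, x \in L -> g (inl x.1) = g (inr x.2)) ->
  {in Lvertices &, forall u v, g u = g v}.
Proof.
move=> gL; set e := fun u v => [&& u \in L, v \in L & adjacent_boxes u v].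
have g_row x y : x \in L -> y \in L -> g (inl x.1) = g (inl y.1).
  move=> xL yL; have e_closed : closed e (fun y => g (inl x.1) == g (inl y.1)).
    apply: intro_closed.
      by apply: sym_connect_sym => u v; rewrite /e andbCA adjacent_boxes_sym.
    move=> u v /and3P[uL vL uv] /eqP xu; rewrite unfold_in xu.
    case/orP: uv => /andP[/eqP uv _]; first by rewrite uv.
    by rewrite !gL ?uv.
  have := closed_connect e_closed (L_connected xL yL).
  by rewrite !unfold_in eqxx => /esym/eqP.
have Lvertex u : u \in Lvertices -> exists2 x, x \in L & g u = g (inl x.1).
  case/imsetP => -[[a aL]|[b bL]] _ -> /=.
    by have /existsP[b abL] := aL; exists (a, b).
  by have /existsP[a abL] := bL; exists (a, b); rewrite // (gL (a, b)).
move=> u v /Lvertex[x xL ->] /Lvertex[y yL ->]; exact: g_row.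
Qed.

Hypothesis L_small : #|L :\: D| < #|Lrow pi| + #|Lcol pi|.


Local Notation L' := (L :\: D).

Lemma below_one_Lset (c a : 'I_N) : pi c <= a -> (a, c) \in NW -> (a, c) \in L'.
Proof.
move=> ca acN; rewrite inE below_one_notin_rothe // Lset_above_one acN.
by apply/existsP; exists c; rewrite /above /= ca leqnn.
Qed.

Lemma right_of_one_Lset (c b : 'I_N) : c <= b -> (pi c, b) \in NW -> (pi c, b) \in L'.
Proof.
move=> cb cbN; rewrite inE right_of_one_notin_rothe // Lset_above_one cbN.
by apply/existsP; exists c; rewrite /above /= cb leqnn.
Qed.

(* For a box of D(pi), any one strictly north-west of it yields a path of length
   three in L(pi) \ D(pi) between its row and its column. *)
Lemma Lset_hook x : x \in L -> x \notin L' ->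
  exists c, [/\ (x.1, c) \in L', one c \in L' & (pi c, x.2) \in L'].
Proof.
move=> xL; rewrite inE xL andbT negbK => xD.
move: (xL); rewrite Lset_above_one => /andP[xN /existsP[c cx]].
have /andP[c1 c2] := above_one_rothe xD cx.
have NWx y : above y x -> y \in NW by move=> yx; apply: northwest_above xN.
exists c; split.
- by apply/below_one_Lset/NWx; rewrite /above /= ?leqnn ltnW.
- exact/below_one_Lset/NWx.
- by apply/right_of_one_Lset/NWx; rewrite /above /= ?leqnn ?andbT ltnW.
Qed.

(** If the ends of [f] stayed connected, the other edges would still connect all rows and columns of
    L, boxes of D(pi) being bridged by [Lset_hook]. That takes at least m + n - 1 edges besides [f],
    against [L_small]. *)
Lemma Lset_tree f : f \in L' ->
  ~ connect (edge_rel (L' :\ f)) (inl f.1) (inr f.2).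
Proof.
move=> fL' f_conn; set F := L' :\ f in f_conn *.
have F_sym := edge_rel_connect_sym F.
have conn_L' x : x \in L' -> connect (edge_rel F) (inl x.1) (inr x.2).
  have [-> //|xf] := eqVneq x f; move=> xL'; apply: connect1.
  by rewrite /edge_rel /= -surjective_pairing; apply/finset.setD1P.
have conn_L x : x \in L -> connect (edge_rel F) (inl x.1) (inr x.2).
  move=> xL; have [/conn_L' //|xL'] := boolP (x \in L').
  have [c [/conn_L' /= xc /conn_L' /= cc /conn_L' /= cx]] := Lset_hook xL xL'.
  by apply: connect_trans xc _; rewrite F_sym in cc; apply: connect_trans cc _.
have fL : f \in L by rewrite inE in fL'; case/andP: fL'.
have fV : inl f.1 \in Lvertices.
  by apply: (@Lvertices_row f.1 f.2); rewrite -surjective_pairing.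
have F_conn : {in Lvertices, forall v, connect (edge_rel F) (inl f.1) v}.
  move=> v vV; apply/(fingraph.rootP F_sym).
  apply: (Lset_const (g := fingraph.root (edge_rel F))) => // x /conn_L.
  exact/(fingraph.rootP F_sym).
have := connected_card F_conn.
rewrite card_Lvertices leqNgt => /negP[].
by have := L_small; rewrite (cardsD1 f L') fL' add1n.
Qed.

Lemma Lset_no_rectangle (r r' c c' : 'I_N) : r != r' -> c != c' ->
  (r, c) \in L' -> (r, c') \in L' -> (r', c) \in L' -> (r', c') \in L' -> False.
Proof.
move=> rr' cc' rc rc' r'c r'c'; apply: (Lset_tree rc) => /=.
set F := _ :\ _.
have in_F x : x \in L' -> x != (r, c) -> x \in F by move=> ? ?; apply/finset.setD1P.
apply: (@connect_trans _ _ (inr c')).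
  by apply/connect1/in_F => //; rewrite xpair_eqE [c' == c]eq_sym (negPf cc') andbF.
apply: (@connect_trans _ _ (inl r')); last first.
  by apply/connect1/in_F => //; rewrite xpair_eqE [r' == r]eq_sym (negPf rr').
rewrite edge_rel_connect_sym; apply/connect1/in_F => //.
by rewrite xpair_eqE [r' == r]eq_sym (negPf rr').
Qed.

(** Two such ones produce a rectangle in L \ D(pi). When the one further right is also lower, the
    two ones are opposite corners of it. *)
Lemma unique_above_one x c c' :
  x \in NW -> above (one c) x -> above (one c') x -> c = c'.
Proof.
wlog cc' : c c' / c < c'.
  move=> W xN cx c'x; have [cc'|cc'|/val_inj //] := ltngtP c c'; first exact: W.
  by apply/esym/W.
move=> xN cx c'x; exfalso.
have ne_cc' : c != c' by rewrite neq_ltn cc'.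
have NWx y : above y x -> y \in NW by move=> yx; apply: northwest_above xN.
have /andP[/= c1 c2] := cx; have /andP[/= c'1 c'2] := c'x.
have in_below (a : 'I_N) : pi c <= a <= x.1 -> (a, c) \in L'.
  by move=> /andP[? ?]; apply/below_one_Lset/NWx => //; apply/andP.
have in_right (b : 'I_N) : c <= b <= x.2 -> (pi c, b) \in L'.
  by move=> /andP[? ?]; apply/right_of_one_Lset/NWx => //; apply/andP.
have [pcc'|pcc'|/val_inj/perm_inj pcc'] := ltngtP (pi c) (pi c').
- apply: (@Lset_no_rectangle (pi c) (pi c') c c') => //.
  + by rewrite neq_ltn pcc'.
  + by apply: in_below; rewrite leqnn.
  + by apply: in_right; rewrite ltnW.
  + by apply: in_below; rewrite ltnW.
  + by apply/below_one_Lset/NWx.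
(* The box (pi c', c) is not known to lie in L. The second row of the rectangle is that of a box [y]
   of D(pi) south-east of (pi c, c'), which is strictly below row pi c. *)
- have /NWx/northwestP[y yD /andP[/= y1 y2]] : above (pi c, c') x by apply/andP.
  have /andP[cy1 _] := @above_one_rothe c y yD (introT andP (conj y1 (ltnW (leq_trans cc' y2)))).
  have yN := rothe_northwest yD.
  have NWy z : above z y -> z \in NW by move=> zy; apply: northwest_above yN.
  apply: (@Lset_no_rectangle (pi c) y.1 c c') => //.
  + by rewrite neq_ltn cy1.
  + by apply: in_below; rewrite leqnn.
  + by apply: in_right; rewrite ltnW.
  + by apply/below_one_Lset/NWy; rewrite /above //= leqnn /= ltnW // (leq_trans cc').
  + by apply/below_one_Lset/NWy; rewrite /above ?leqnn //= (leq_trans (ltnW pcc')).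
- by rewrite pcc' ltnn in cc'.
Qed.

Lemma adjacent_above (x y : box) : adjacent_boxes x y -> above x y || above y x.
Proof.
by rewrite /above => /orP[] /andP[/eqP xy /orP[] /eqP]; rewrite ?xy; lia.
Qed.

(** Only a step north-west along a path of L could leave the quadrant of the one. The new box has
    some one north-west of it; this is also north-west of the old box, hence is the same one. *)
Lemma Lset_above_unique_one c x : one c \in NW -> x \in L -> above (one c) x.
Proof.
move=> cN xL; have cL := one_Lset cN.
set e := fun u v => [&& u \in L, v \in L & adjacent_boxes u v].
have e_closed : closed e (fun y => above (one c) y).
  apply: intro_closed.
    by apply: sym_connect_sym => u v; rewrite /e andbCA adjacent_boxes_sym.
  move=> u v /and3P[uL vL /adjacent_above/orP[uv|vu]] cu; rewrite unfold_in.
    exact: above_trans uv.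
  move: vL; rewrite Lset_above_one => /andP[_ /existsP[c' c'v]].
  by rewrite (unique_above_one (Lset_northwest uL) cu (above_trans c'v vu)).
have := closed_connect e_closed (L_connected cL xL).
by rewrite !unfold_in above_refl => /esym.
Qed.

(** Both boxes are south-east of the same one; moving the one with the larger column west to the
    other column stays in that quadrant and in NW(pi). *)
Lemma Lgraph_nested (a a' : Lrow pi) (b b' : Lcol pi) :
  Lgraph a b -> Lgraph a' b' -> Lgraph a b' || Lgraph a' b.
Proof.
rewrite /Lgraph => abL a'b'L.
have : (val a, val b) \in L by [].
rewrite Lset_above_one => /andP[_ /existsP[c cab]].
have cN : one c \in NW by apply: northwest_above (Lset_northwest abL).
have /andP[ca cb] := cab; have /andP[ca' cb'] := Lset_above_unique_one cN a'b'L.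
apply/orP; have [bb'|b'b] := leqP (val b) (val b'); [right|left].
  rewrite Lset_above_one (@northwest_above _ (val a', val b')) ?Lset_northwest //.
    by apply/existsP; exists c; apply/andP.
  by apply/andP; rewrite leqnn.
rewrite Lset_above_one (@northwest_above _ (val a, val b)) ?Lset_northwest //.
  by apply/existsP; exists c; apply/andP.
by apply/andP; rewrite leqnn ltnW.
Qed.

(** With [one c] the one in L, the full lines are the rows pi c and pi c + 1 and the columns c and c
    + 1: a box of D(pi) beyond the hook of the one lies strictly below and to the right of it. The
    third row is that of an essential box. *)
Lemma Lset_ferrers : 3 <= #|essential pi :&: L| ->
  exists (r1 r2 r3 : Lrow pi) (c1 c2 : Lcol pi),
    [/\ r1 != r2, r3 != r1 /\ r3 != r2, c1 != c2,
        forall b, Lgraph r1 b /\ Lgraph r2 b & forall a, Lgraph a c1 /\ Lgraph a c2].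
Proof.
move=> ess3; have /card_gt1P[x [y [xE yE xy]]] : 1 < #|essential pi :&: L| by apply: leq_trans ess3.
have [xEss xL] : x \in essential pi /\ x \in L by apply/finset.setIP.
have [yEss yL] : y \in essential pi /\ y \in L by apply/finset.setIP.
have ess_rothe z : z \in essential pi -> z \in D by rewrite inE => /andP[].
have xD := ess_rothe x xEss; have yD := ess_rothe y yEss.
move: (xL); rewrite Lset_above_one => /andP[xN /existsP[c cx]].
have cN : one c \in NW by apply: northwest_above xN.
have aboveL z : z \in L -> above (one c) z by apply: Lset_above_unique_one.
have inL z : above (one c) z -> z \in NW -> z \in L.
  by move=> cz zN; rewrite Lset_above_one zN; apply/existsP; exists c.
(* A box outside D(pi) is weakly below the one of its column or weakly right of the one of its row;
   here that would be a second one north-west of [z]. *)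
have inD z : z \in NW -> pi c < z.1 -> c < z.2 -> z \in D.
  move=> zN cz1 cz2; apply: contraT; rewrite mem_rothe negb_and -!leqNgt => /orP[z1|z2].
    suff e : c = z.2 by move: cz2; rewrite -e ltnn.
    apply: (unique_above_one zN); last by apply/andP; split.
    by apply/andP; split; apply: ltnW.
  suff e : c = (pi^-1)%g z.1 by move: cz1; rewrite e permKV ltnn.
  apply: (unique_above_one zN); first by apply/andP; split; apply: ltnW.
  by apply/andP; split; rewrite /= ?permKV.
have cL : one c \in L by apply: one_Lset.
have /andP[cx1 cx2] := above_one_rothe xD cx.
have /andP[cy1 cy2] := above_one_rothe yD (aboveL y yL).
have r'N : (pi c).+1 < N by apply: leq_ltn_trans (ltn_ord x.1).
have c'N : c.+1 < N by apply: leq_ltn_trans (ltn_ord x.2).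
have below1 b : (pi c, b) \in L -> (Ordinal r'N, b) \in L.
  move=> bL; have /andP[/= _ cb] := aboveL _ bL.
  have /northwestP[z zD /andP[/= z1 z2]] := Lset_northwest bL.
  have /andP[cz1 _] := @above_one_rothe c z zD (introT andP (conj z1 (leq_trans cb z2))).
  apply: inL; first by rewrite /above /= leqnSn cb.
  by apply/northwestP; exists z; rewrite // /above /= cz1 z2.
have right1 a : (a, c) \in L -> (a, Ordinal c'N) \in L.
  move=> aL; have /andP[/= ca _] := aboveL _ aL.
  have /northwestP[z zD /andP[/= z1 z2]] := Lset_northwest aL.
  have /andP[_ cz2] := @above_one_rothe c z zD (introT andP (conj (leq_trans ca z1) z2)).
  apply: inL; first by rewrite /above /= leqnSn ca.
  by apply/northwestP; exists z; rewrite // /above /= cz2 z1.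
have rowP (a b : 'I_N) : (a, b) \in L -> [exists b, (a, b) \in L].
  by move=> ?; apply/existsP; exists b.
have colP (a b : 'I_N) : (a, b) \in L -> [exists a, (a, b) \in L].
  by move=> ?; apply/existsP; exists a.
have zL z : z \in L -> (z.1, z.2) \in L by rewrite -surjective_pairing.
have [z [zL' zr zc]] : exists z, [/\ z \in L, z.1 != pi c & z.1 != Ordinal r'N].
  have row_neq (z : box) : pi c < z.1 -> z.1 != pi c by rewrite -val_eqE neq_ltn orbC => ->.
  have [x1|x1] := eqVneq x.1 (Ordinal r'N); last by exists x; split=> //; apply: row_neq.
  have [y1|y1] := eqVneq y.1 (Ordinal r'N); last by exists y; split=> //; apply: row_neq.
  exfalso; have xy1 : x.1 = y.1 by rewrite x1 y1.
  (* Two essential boxes cannot share this row: the right neighbour of the left one would be in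
     NW(pi) and strictly south-east of the one, hence in D(pi). *)
  have ess_right u v : u \in essential pi -> v \in NW -> u.1 = v.1 ->
      pi c < u.1 -> c < u.2 -> u.2 < v.2 -> False.
    move=> uE vN uv1 cu1 cu2 uv.
    have u'N : u.2.+1 < N by apply: leq_ltn_trans (ltn_ord v.2).
    move: uE; rewrite inE => /andP[_ /forallP/(_ (u.1, Ordinal u'N))].
    rewrite inD /= ?eqxx ?andbF //; last exact: ltnW.
    by apply: northwest_above vN; rewrite /above /= uv1 leqnn.
  have [xy2|xy2|/val_inj xy2] := ltngtP x.2 y.2.
  - exact: (ess_right x y xEss (rothe_northwest yD)).
  - exact: (ess_right y x yEss (rothe_northwest xD)).
  - by case/eqP: xy; rewrite [x]surjective_pairing [y]surjective_pairing xy1 xy2.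
exists (exist _ (pi c) (rowP _ _ cL)), (exist _ (Ordinal r'N) (rowP _ _ (below1 _ cL))).
exists (exist _ z.1 (rowP _ _ (zL z zL'))).
exists (exist _ c (colP _ _ cL)), (exist _ (Ordinal c'N) (colP _ _ (right1 _ cL))).
split=> //.
- by rewrite -val_eqE /= -val_eqE /= neq_ltn leqnn.
- by rewrite -val_eqE /= -val_eqE /= neq_ltn leqnn.
- case=> b bL; rewrite /Lgraph /=.
  suff cbL : (pi c, b) \in L by split=> //; apply: below1.
  have /existsP[a abL] := bL; have /andP[/= ca cb] := aboveL _ abL.
  apply: inL; first by rewrite /above /= leqnn cb.
  by apply: northwest_above (Lset_northwest abL); rewrite /above /= ca leqnn.
- case=> a aL; rewrite /Lgraph /=.
  suff acL : (a, c) \in L by split=> //; apply: right1.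
  have /existsP[b abL] := aL; have /andP[/= ca cb] := aboveL _ abL.
  apply: inL; first by rewrite /above /= leqnn ca.
  by apply: northwest_above (Lset_northwest abL); rewrite /above /= cb leqnn.
Qed.

End Tree.
End RotheDiagram.

Local Open Scope ring_scope.

(** * Faces of the edge cone *)

Lemma ord2_ind (P : 'I_2 -> Prop) : P ord0 -> P ord_max -> forall k, P k.
Proof.
move=> P0 P1 k.
have [->|k0] := eqVneq k ord0; first exact: P0.
suff -> : k = ord_max by exact: P1.
by apply/val_inj; case: k k0 => -[|[|k]].
Qed.

Lemma tnth_pair0 (T : Type) (x y : T) : tnth [tuple x; y] ord0 = x.
Proof. by []. Qed.

Lemma tnth_pair1 (T : Type) (x y : T) : tnth [tuple x; y] ord_max = y.
Proof. by []. Qed.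

Section EdgeCone.
Variables (U1 U2 : finType) (E : U1 -> U2 -> bool).
Local Notation V := (U1 + U2)%type.
Local Notation vec := {ffun V -> rat^o}.
Local Notation line := (@line_gen U1 U2).

Definition edge_val (y : vec) (a : U1) (b : U2) : rat := y (inl a) + y (inr b).

Lemma edge_valD (y z : vec) a b :
  edge_val (y + z) a b = edge_val y a b + edge_val z a b.
Proof. by rewrite /edge_val !ffunE /=; ring. Qed.

Lemma edge_valZ (y : vec) c a b : edge_val (c *: y) a b = c * edge_val y a b.
Proof. by rewrite /edge_val !ffunE mulrDr. Qed.

Lemma edge_val_line a b : edge_val line a b = 0.
Proof. by rewrite /edge_val !ffunE subrr. Qed.

Lemma sum_V (f : V -> rat) :
  \sum_v f v = \sum_a f (inl a) + \sum_b f (inr b).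
Proof. by rewrite big_sumType. Qed.

Lemma pairing_edge (y : vec) a b : pairing (edge_vec a b) y = edge_val y a b.
Proof.
rewrite /pairing /edge_val sum_V (bigD1 a) //= (bigD1 b) //= !big1.
- by rewrite !ffunE !eqxx /= !addr0 add0r !mul1r.
- move=> j jb; rewrite !ffunE /=.
  have -> : (inr j == inr b :> V) = false by apply: contra_neqF jb => /eqP[].
  by rewrite addr0 mul0r.
- move=> j jb; rewrite !ffunE /=.
  have -> : (inl j == inl a :> V) = false by apply: contra_neqF jb => /eqP[].
  by rewrite addr0 mul0r.
Qed.

Lemma pairingC (x y : vec) : pairing x y = pairing y x.
Proof. by apply: eq_bigr => v _; rewrite mulrC. Qed.

Lemma pairing_lin (x y z : vec) c :
  pairing x (c *: y + z) = c * pairing x y + pairing x z.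
Proof.
rewrite /pairing mulr_sumr -big_split /=; apply: eq_bigr => v _.
by rewrite !ffunE /GRing.scale /=; ring.
Qed.

Lemma pairing0 (x : vec) : pairing x 0 = 0.
Proof. by rewrite /pairing big1 // => v _; rewrite ffunE mulr0. Qed.

Lemma pairingZ (x y : vec) c : pairing x (c *: y) = c * pairing x y.
Proof. by rewrite -[c *: y]addr0 pairing_lin pairing0 addr0. Qed.

Lemma pairingD (x y z : vec) : pairing x (y + z) = pairing x y + pairing x z.
Proof. by rewrite -[y]scale1r pairing_lin mul1r scale1r. Qed.

Lemma pairing_sum (c : U1 -> U2 -> rat) (y : vec) :
  pairing (\sum_a \sum_(b | E a b) c a b *: edge_vec a b) y =
  \sum_a \sum_(b | E a b) c a b * edge_val y a b.
Proof.
have pairing_bigsum := big_morph (pairing y) (pairingD y) (pairing0 y).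
rewrite pairingC pairing_bigsum; apply: eq_bigr => a _.
rewrite pairing_bigsum; apply: eq_bigr => b _.
by rewrite pairingZ pairingC pairing_edge.
Qed.

Lemma edge_vec_dual a b : E a b -> dual_edge_cone E (edge_vec a b).
Proof.
move=> ab; exists (fun a' b' => ((a' == a) && (b' == b))%:R).
split=> [*|]; first exact: ler0n.
rewrite (bigD1 a) // (bigD1 b) // !eqxx scale1r.
rewrite [X in _ = _ + X + _]big1 ?addr0; last first.
  by move=> b' /andP[_ /negPf ->]; rewrite andbF scale0r.
rewrite big1 ?addr0 // => a' /andP[_ /negPf aa].
by rewrite big1 // => b' _; rewrite aa scale0r.
Qed.

Lemma edge_coneP (y : vec) :
  edge_cone E y <-> forall a b, E a b -> 0 <= edge_val y a b.
Proof.
split=> [yc a b ab | yE x [c [c0 ->]]].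
- by rewrite -pairing_edge; apply/yc/edge_vec_dual.
- rewrite pairing_sum; apply: sumr_ge0 => a _; apply: sumr_ge0 => b ab.
  by rewrite mulr_ge0 // yE.
Qed.

Lemma pairing_line (x : vec) : dual_edge_cone E x -> pairing x line = 0.
Proof.
case=> c [_ ->]; rewrite pairing_sum big1 // => a _; rewrite big1 // => b _.
by rewrite edge_val_line mulr0.
Qed.

Lemma edge_val_eqN (y z : vec) a b : eqN y z -> edge_val y a b = edge_val z a b.
Proof. by case=> c ->; rewrite edge_valD edge_valZ edge_val_line mulr0 addr0. Qed.

Lemma pairing_eqN (x y z : vec) :
  dual_edge_cone E x -> eqN y z -> pairing x y = pairing x z.
Proof.
move=> xd [c ->].
by rewrite addrC pairing_lin pairing_line // mulr0 add0r.
Qed.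

(** The sum of the edge vectors over [F] defines the face: on the cone its pairing is a sum of
    nonnegative terms, which vanishes only termwise. *)
Lemma tight_is_face (F : U1 -> U2 -> bool) :
  is_face E (fun y => edge_cone E y /\
    forall a b, E a b -> F a b -> edge_val y a b = 0).
Proof.
pose x : vec := \sum_a \sum_(b | E a b) (F a b)%:R *: edge_vec a b.
exists x; first by exists (fun a b => (F a b)%:R); split=> // *; exact: ler0n.
apply/funext => y; apply/propext; split=> -[yc yF]; split=> //.
- rewrite /x pairing_sum big1 // => a _; rewrite big1 // => b ab.
  by case Fab : (F a b); rewrite ?mul0r // yF ?mulr0.
- move=> a b ab Fab; move: yF; rewrite /x pairing_sum => yF.
  have yE := (edge_coneP y).1 yc.
  have T0 a' b' : E a' b' -> 0 <= (F a' b')%:R * edge_val y a' b'.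
    by move=> *; rewrite mulr_ge0 ?ler0n ?yE.
  have := @psumr_eq0P _ _ xpredT
    (fun a => \sum_(b | E a b) (F a b)%:R * edge_val y a b) _ yF a isT.
  have /[swap]/[apply] yFa : forall i, true -> 
     0 <= \sum_(b | E i b) (F i b)%:R * edge_val y i b.
    by move=> i _; apply: sumr_ge0 => b' ?; apply: T0.
  by have := psumr_eq0P (@T0 a) yFa ab; rewrite Fab mul1r.
Qed.

Lemma sum_part (x : vec) : dual_edge_cone E x ->
  \sum_a x (inl a) = \sum_b x (inr b).
Proof.
move=> /pairing_line; rewrite /pairing sum_V.
under eq_bigr => a _ do rewrite ffunE mulr1.
under [X in _ + X]eq_bigr => b _ do rewrite ffunE mulrN1.
by rewrite sumrN => /eqP; rewrite subr_eq0 => /eqP.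
Qed.

Lemma sum_setV (A : {set V}) (f : V -> rat) :
  \sum_(v in A) f v =
  \sum_(a | inl a \in A) f (inl a) + \sum_(b | inr b \in A) f (inr b).
Proof. by rewrite big_sumType. Qed.

Lemma hyperplane_edge (A : {set V}) a b :
  ((inl a \in A) + (inr b \in A) = (inl a \in nbhd E A) + (inr b \in nbhd E A))%N ->
  hyperplane E A (edge_vec a b).
Proof.
suff sumE (S : {set V}) :
    \sum_(v in S) edge_vec a b v = ((inl a \in S) + (inr b \in S))%N%:R.
  by rewrite /hyperplane !sumE => ->.
rewrite sum_setV natrD; congr (_ + _).
- rewrite big_mkcond (bigD1 a) //= big1 ?addr0.
    by rewrite ffunE eqxx addr0; case: ifP.
  move=> a' /negPf aa; case: ifP => // _; rewrite ffunE /= addr0.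
  by rewrite (_ : (inl a' == inl a :> V) = (a' == a)) ?aa.
- rewrite big_mkcond (bigD1 b) //= big1 ?addr0.
    by rewrite ffunE eqxx add0r; case: ifP.
  move=> a' /negPf aa; case: ifP => // _; rewrite ffunE /= add0r.
  by rewrite (_ : (inr a' == inr b :> V) = (a' == b)) ?aa.
Qed.

Lemma cone_spanned1 (p y : vec) :
  cone_spanned (fun _ : 'I_1 => p) y <-> exists2 c, 0 <= c & eqN y (c *: p).
Proof.
split=> [[c [c0]]|[c c0 yp]]; first by rewrite big_ord1; exists (c ord0).
by exists (fun=> c); split=> //; rewrite big_ord1.
Qed.

Lemma cone_spanned2 (p : 'I_2 -> vec) (y : vec) :
  cone_spanned p y <->
  exists c d, [/\ 0 <= c, 0 <= d & eqN y (c *: p ord0 + d *: p ord_max)].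
Proof.
split=> [[c [c0]]|[c [d [c0 d0 yp]]]].
  rewrite big_ord_recl big_ord1 (_ : lift ord0 ord0 = ord_max);
    [by exists (c ord0), (c ord_max) | exact/val_inj].
exists (fun k => if k == ord0 then c else d); split=> [k|]; first by case: ifP.
by rewrite big_ord_recl big_ord1 (_ : lift ord0 ord0 = ord_max) //; apply/val_inj.
Qed.

Definition pair_vec (p q : vec) : 'I_2 -> vec :=
  fun k => if k == ord0 then p else q.

Lemma eqN_refl (y : vec) : eqN y y.
Proof. by exists 0; rewrite scale0r addr0. Qed.

(** Reduces a dual face to edges: those on which [p] vanishes lie on the hyperplane of [A], and
    vanishing on them forces an element of the cone onto the ray of [p]. *)
Lemma ray_dual_face (A : {set V}) (p : vec) :
  edge_cone E p ->
  (forall x, dual_edge_cone E x -> hyperplane E A x -> pairing x p = 0) ->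
  (forall a b, E a b -> edge_val p a b = 0 -> hyperplane E A (edge_vec a b)) ->
  (forall y, edge_cone E y ->
    (forall a b, E a b -> edge_val p a b = 0 -> edge_val y a b = 0) ->
    exists2 c, 0 <= c & eqN y (c *: p)) ->
  dual_face E A = cone_spanned (fun _ : 'I_1 => p).
Proof.
move=> pc pA pH py; apply/funext => y; apply/propext; split.
- case=> yc yA; apply/cone_spanned1; apply: py => // a b ab pab.
  rewrite -pairing_edge; apply: yA; [exact: edge_vec_dual|exact: pH].
- move=> /cone_spanned1[c c0 yp]; split.
    apply/edge_coneP => a b ab; rewrite (edge_val_eqN _ _ yp) edge_valZ.
    by rewrite mulr_ge0 //; apply: (edge_coneP p).1.
  by move=> x xd xA; rewrite (pairing_eqN xd yp) pairingZ pA ?mulr0.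
Qed.

(** A vector congruent to [k] times a lattice vector has edge values divisible by [k]. *)
Lemma primitive_edge_val1 (p : vec) a b :
  lattice p -> edge_val p a b = 1 -> primitive p.
Proof.
move=> pl pab; split=> // k q ql pq.
have : edge_val p a b = k%:R * edge_val q a b.
  by rewrite (edge_val_eqN _ _ pq) -scaler_nat edge_valZ.
have : edge_val q a b \is a Num.int by rewrite rpredD ?ql.
move=> /intrP[m ->]; rewrite pab => km.
have /(@intr_inj rat) : (1%:~R : rat) = (k%:Z * m)%:~R by rewrite intrM -km.
by move=> /(congr1 absz); rewrite abszM => /esym/eqP; rewrite muln_eq1 => /andP[/eqP].
Qed.

Lemma span_dim_pair (p q : vec) a b a' b' :
  edge_val p a b != 0 -> edge_val q a b = 0 ->
  edge_val p a' b' = 0 -> edge_val q a' b' != 0 ->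
  span_dim (pair_vec p q) = 2%N.
Proof.
move=> p0 q0 p'0 q'0.
have line0 : line != 0.
  by apply/eqP => /ffunP/(_ (inl a)); rewrite !ffunE => /eqP; rewrite oner_eq0.
have span_eq : (<<[seq pair_vec p q k | k : 'I_2]>> + <[line]> =
                <<[:: p; q; line]>>)%VS.
  rewrite -span_seq1 -span_cat; congr (span _).
  by rewrite /image_mem enum_ordSl enum_ordSl enum_ord0.
suff pq_free : free [:: p; q; line].
  by rewrite /span_dim span_eq; move: pq_free; rewrite /free => /eqP ->; rewrite dim_vline line0.
rewrite !free_cons; apply/and3P; split.
- apply/negP; rewrite span_cons span_seq1 => /memv_addP[_ /vlineP[c ->]].
  case=> _ /vlineP[d ->] pE; case/eqP: p0.
  by rewrite pE edge_valD !edge_valZ q0 edge_val_line !mulr0 addr0.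
- apply/negP; rewrite span_seq1 => /vlineP[c qE]; case/eqP: q'0.
  by rewrite qE edge_valZ edge_val_line mulr0.
- by rewrite span_nil memv0 line0 nil_free.
Qed.

(** The last hypothesis makes the cone of [p] and [q] equal to the face given by [tight_is_face] for
    the edges on which both vanish. *)
Lemma independent_face_pair (A B : {set V}) (p q : vec) :
  first_independent E A -> first_independent E B ->
  ray_generator E A p -> ray_generator E B q ->
  edge_cone E p -> edge_cone E q ->
  span_dim (pair_vec p q) = 2%N ->
  (forall y, edge_cone E y ->
    (forall a b, E a b -> edge_val p a b = 0 -> edge_val q a b = 0 ->
      edge_val y a b = 0) ->
    exists c d, [/\ 0 <= c, 0 <= d & eqN y (c *: p + d *: q)]) ->
  independent_face E [tuple A; B].
Proof.
move=> Af Bf Ap Bq pc qc pq2 pq_span; split.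
  apply: ord2_ind.
  rewrite tnth_pair0.
  exact: Af.
  rewrite tnth_pair1.
  exact: Bf.
exists (pair_vec p q); split; last exact: pq2.
  apply: ord2_ind.
  by rewrite tnth_pair0; exact: Ap.
  by rewrite tnth_pair1; exact: Bq.
suff -> : cone_spanned (pair_vec p q) = (fun y => edge_cone E y /\
    forall a b, E a b -> (edge_val p a b == 0) && (edge_val q a b == 0) ->
      edge_val y a b = 0) by exact: tight_is_face.
apply/funext => y; apply/propext; rewrite cone_spanned2 /=; split.
- case=> c [d [c0 d0 yE]]; split.
    apply/edge_coneP => a b ab; rewrite (edge_val_eqN _ _ yE) edge_valD !edge_valZ.
    by apply: addr_ge0; apply: mulr_ge0 => //; apply: (edge_coneP _).1 ab.
  move=> a b ab /andP[/eqP pab /eqP qab]; rewrite (edge_val_eqN _ _ yE).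
  by rewrite edge_valD !edge_valZ pab qab !mulr0 addr0.
- case=> yc y0; apply: pq_span => // a b ab pab qab.
  by apply: y0 => //; rewrite pab qab eqxx.
Qed.

Lemma dual_face_gen (S : {set V}) (p q : vec) :
  dual_face E S = cone_spanned (fun _ : 'I_1 => p) ->
  dual_face E S = cone_spanned (fun _ : 'I_1 => q) ->
  exists2 c, 0 <= c & eqN p (c *: q).
Proof.
move=> -> /(congr1 (@^~ p)) pq; apply/cone_spanned1; rewrite -pq.
by apply/cone_spanned1; exists 1; rewrite // scale1r; apply: eqN_refl.
Qed.

(** Needed to refute [independent_face], whose representatives of the rays are not the chosen
    ones. *)
Lemma ray_generator_dual_face (A : {set V}) (p q : vec) :
  A != finset.set0 -> ray_generator E A p -> ray_generator E A q ->
  exists2 c, 0 <= c & eqN p (c *: q).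
Proof.
move=> A0 [_ Ap] [_ Aq].
have [s As] : exists s, A :&: part s != finset.set0.
  case/set0Pn: A0 => -[a|b] vA.
    by exists true; apply/set0Pn; exists (inl a); rewrite !inE vA.
  by exists false; apply/set0Pn; exists (inr b); rewrite !inE vA.
exact: dual_face_gen (Ap s As) (Aq s As).
Qed.

Lemma eqN_lin (y z y' z' : vec) c d :
  eqN y y' -> eqN z z' -> eqN (c *: y + d *: z) (c *: y' + d *: z').
Proof.
case=> e -> [f ->]; exists (c * e + d * f).
by rewrite !scalerDr !scalerA scalerDl addrACA.
Qed.

Lemma eqN_trans (y z w : vec) : eqN y z -> eqN z w -> eqN y w.
Proof. by case=> c -> [d ->]; exists (d + c); rewrite scalerDl addrA. Qed.

(* A face containing a sum of two points of the cone contains both points. *)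
Lemma not_independent_face_pair (A B : {set V}) (p q w : vec) :
  A != finset.set0 -> B != finset.set0 ->
  ray_generator E A p -> ray_generator E B q ->
  edge_cone E p -> edge_cone E q ->
  edge_cone E w -> edge_cone E (p + q - w) ->
  (forall c d, ~ eqN w (c *: p + d *: q)) ->
  ~ independent_face E [tuple A; B].
Proof.
move=> A0 B0 Ap Bq pc qc wc pqwc w_out [_ [r [r_gen [x xd r_face] _]]].
have := r_gen ord0; rewrite tnth_pair0 => Ar.
have := r_gen ord_max; rewrite tnth_pair1 => Br.
have [c c0 rp] := ray_generator_dual_face A0 Ar Ap.
have [d d0 rq] := ray_generator_dual_face B0 Br Bq.
have [c' c'0 pr] := ray_generator_dual_face A0 Ap Ar.
have [d' d'0 qr] := ray_generator_dual_face B0 Bq Br.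
have x0 (y : vec) : cone_spanned r y -> pairing x y = 0 by rewrite r_face => -[].
have xr k : pairing x (r k) = 0.
  apply: x0; exists (fun l => (l == k)%:R); split=> [l|]; first exact: ler0n.
  rewrite (bigD1 k) //= eqxx scale1r big1 ?addr0 => [|l /negPf ->].
    exact: eqN_refl.
  by rewrite scale0r.
have xp : pairing x p = 0 by rewrite (pairing_eqN xd pr) pairingZ xr mulr0.
have xq : pairing x q = 0 by rewrite (pairing_eqN xd qr) pairingZ xr mulr0.
have xw : pairing x w = 0.
  have := pqwc x xd; have := wc x xd.
  rewrite -scaleN1r pairingD pairingD pairingZ xp xq => w0 w1; lra.
have : cone_spanned r w by rewrite r_face.
move=> /cone_spanned2[e [f [_ _ wE]]].
apply: (w_out (e * c) (f * d)); apply: eqN_trans wE _.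
by rewrite -!scalerA; apply: eqN_lin.
Qed.

End EdgeCone.

(** * First independent sets of Ferrers graphs *)

Section Ferrers.
Variables (U1 U2 : finType) (E : U1 -> U2 -> bool).
Local Notation V := (U1 + U2)%type.
Local Notation vec := {ffun V -> rat^o}.
Local Notation line := (@line_gen U1 U2).

Definition unit_vec (v : V) : vec := [ffun w => (w == v)%:R].

Definition gap_vec (C : {set V}) : vec :=
  [ffun v => if v is inl _ then - (v \in C)%:R else (v \notin C)%:R].

Lemma eqN_ext (y z : vec) c :
  (forall a, y (inl a) = z (inl a) + c) ->
  (forall b, y (inr b) = z (inr b) - c) -> eqN y z.
Proof.
move=> yz1 yz2; exists c; apply/ffunP => -[a|b]; rewrite !ffunE.
  by rewrite yz1; congr (_ + _); rewrite /GRing.scale /= mulr1.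
by rewrite yz2; congr (_ + _); rewrite /GRing.scale /= mulrN1.
Qed.

Lemma inl_eq (a a' : U1) : (inl a == inl a' :> V) = (a == a'). Proof. by []. Qed.
Lemma inr_eq (b b' : U2) : (inr b == inr b' :> V) = (b == b'). Proof. by []. Qed.

Lemma edge_val_unitl i a b : edge_val (unit_vec (inl i)) a b = (a == i)%:R.
Proof. by rewrite /edge_val !ffunE inl_eq addr0. Qed.

Lemma edge_val_unitr j a b : edge_val (unit_vec (inr j)) a b = (b == j)%:R.
Proof. by rewrite /edge_val !ffunE inr_eq add0r. Qed.

Lemma edge_val_gap C a b :
  edge_val (gap_vec C) a b = (inr b \notin C)%:R - (inl a \in C)%:R.
Proof. by rewrite /edge_val !ffunE addrC. Qed.

Lemma edge_cone_unit v : edge_cone E (unit_vec v).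
Proof.
apply/edge_coneP => a b _; case: v => ?;
  by rewrite ?edge_val_unitl ?edge_val_unitr ler0n.
Qed.

Lemma in_partl s a : (inl a \in (part s : {set V})) = s.
Proof. by rewrite inE; case: s. Qed.

Lemma in_partr s b : (inr b \in (part s : {set V})) = ~~ s.
Proof. by rewrite inE; case: s. Qed.

Lemma in_nbhdl (S : {set V}) a :
  (inl a \in nbhd E S) = [exists b, (inr b \in S) && E a b].
Proof.
rewrite inE; apply/existsP/existsP => -[]; last first.
  by move=> b /andP[bS ab]; exists (inr b); rewrite bS.
by case=> [a'|b] /andP[S' //= ab]; exists b; rewrite S'.
Qed.

Lemma in_nbhdr (S : {set V}) b :
  (inr b \in nbhd E S) = [exists a, (inl a \in S) && E a b].
Proof.
rewrite inE; apply/existsP/existsP => -[]; last first.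
  by move=> a /andP[aS ab]; exists (inl a); rewrite aS.
by case=> [a|b'] /andP[S' //= ab]; exists a; rewrite S'.
Qed.

Lemma sum_part_set (x : vec) s : dual_edge_cone E x ->
  \sum_(v in part s) x v = \sum_(v in part (~~ s)) x v.
Proof.
move=> /sum_part xE; rewrite !sum_setV.
under eq_bigl do rewrite in_partl.
under [X in _ + X]eq_bigl do rewrite in_partr.
under [X in _ = X + _]eq_bigl do rewrite in_partl.
under [X in _ = _ + X]eq_bigl do rewrite in_partr.
by case: s => /=; rewrite !big_pred0_eq ?addr0 ?add0r xE.
Qed.

Lemma pairing_unit (x : vec) v : pairing x (unit_vec v) = x v.
Proof.
rewrite /pairing (bigD1 v) //= ffunE eqxx mulr1 big1 ?addr0 // => w /negPf wv.
by rewrite ffunE wv mulr0.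
Qed.

(** As the neighbourhood is the whole other part and both parts have the same coordinate sum on the
    dual cone, the hyperplane is x_v = 0. *)
Lemma ray_generator_unit s v a0 b0 :
  v \in part s -> nbhd E (part s :\ v) = part (~~ s) ->
  E a0 b0 -> edge_val (unit_vec v) a0 b0 = 1 ->
  (forall y, edge_cone E y ->
    (forall a b, E a b -> edge_val (unit_vec v) a b = 0 ->
       edge_val y a b = 0) ->
    exists2 c, 0 <= c & eqN y (c *: unit_vec v)) ->
  ray_generator E (part s :\ v) (unit_vec v).
Proof.
move=> vs Nv ab0 v1 span_v; split.
  by apply: (@primitive_edge_val1 _ _ _ a0 b0) => // w; rewrite ffunE; case: eqP.
move=> s' ss'; have {s' ss'}-> : (part s :\ v) :&: part s' = part s :\ v.
  suff <- : s = s' by apply/finset.setIidPl/finset.subsetDl.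
  case/finset.set0Pn: ss' => w; rewrite !inE => /andP[/andP[_ /eqP <-] /eqP <-] //.
apply: ray_dual_face => //; first exact: edge_cone_unit.
- move=> x xd; rewrite /hyperplane Nv -sum_part_set // pairing_unit.
  by rewrite [in X in _ = X](big_setD1 v) //= => xE; lra.
- move=> a b ab vab; apply: hyperplane_edge; rewrite Nv !inE.
  move: vs vab; rewrite inE => /eqP <-.
  case: (v) => w /=; rewrite ?edge_val_unitl ?edge_val_unitr ?inl_eq ?inr_eq.
    by case: eqVneq => // _ /eqP; rewrite oner_eq0.
  by case: eqVneq => // _ /eqP; rewrite oner_eq0.
Qed.

(* Two-sided maximal independent sets: [C] meets both parts and each of its two
   halves is the set of the vertices not adjacent to the other one. *)
Definition gap (C : {set V}) : Prop :=
  [/\ forall a, (inl a \in C) = [forall b, (inr b \in C) ==> ~~ E a b],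
      forall b, (inr b \in C) = [forall a, (inl a \in C) ==> ~~ E a b],
      exists a, inl a \in C & exists b, inr b \in C].

Lemma gap_indep C a b : gap C -> inl a \in C -> inr b \in C -> ~~ E a b.
Proof. by case=> -> _ _ _ /forallP/(_ b)/implyP. Qed.

Lemma gap_row C a : gap C -> inl a \notin C -> exists2 b, inr b \in C & E a b.
Proof.
case=> -> _ _ _; rewrite negb_forall => /existsP[b].
by rewrite negb_imply negbK => /andP[]; exists b.
Qed.

Lemma gap_col C b : gap C -> inr b \notin C -> exists2 a, inl a \in C & E a b.
Proof.
case=> _ -> _ _; rewrite negb_forall => /existsP[a].
by rewrite negb_imply negbK => /andP[]; exists a.
Qed.

Lemma gap_eq C C' : gap C -> gap C' ->
  (forall a, (inl a \in C) = (inl a \in C')) -> C = C'.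
Proof.
case=> _ C2 _ _ [_ C2' _ _] CC'; apply/finset.setP => -[a|b] //.
by rewrite C2 C2'; apply: eq_forallb => a; rewrite CC'.
Qed.

Lemma gap_properP C C' : gap C -> gap C' -> C <> C' ->
  (forall a, inl a \in C' -> inl a \in C) ->
  exists2 a, inl a \in C & inl a \notin C'.
Proof.
move=> Cg Cg' CC' C'C.
have [/existsP[a /andP[]]|CeC'] :=
  boolP [exists a, (inl a \in C) && (inl a \notin C')]; first by exists a.
case: CC'; apply: gap_eq => // a; apply/idP/idP => [aC|]; last exact: C'C.
by apply: contraNT CeC' => aC'; apply/existsP; exists a; rewrite aC.
Qed.

Lemma adj_sym : ssrbool.symmetric (adj E).
Proof. by move=> [a|b] [a'|b']. Qed.

Lemma independentU1 C v : independent E C ->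
  (forall w, w \in C -> ~~ adj E v w) -> independent E (v |: C).
Proof.
case/andP=> _ /forall_inP C_indep vC; apply/andP; split.
  by apply/finset.set0Pn; exists v; rewrite finset.setU11.
apply/forall_inP => u /finset.setU1P uC; apply/forall_inP => w /finset.setU1P wC.
case: uC wC => [->|uC] [->|wC]; last exact: (forall_inP (C_indep u uC)).
- by case: (v).
- exact: vC.
- by rewrite adj_sym vC.
Qed.

Lemma max_independentU1 C v : max_independent E C ->
  (forall w, w \in C -> ~~ adj E v w) -> v \in C.
Proof.
case/and3P=> C_indep _ /forallP/(_ (v |: C)) C_max vC.
by move: C_max; rewrite independentU1 //= finset.subsetUr /= => /eqP <-; rewrite finset.setU11.
Qed.

(** The one-sided alternative misses a part altogether, so [C] is maximal and contains every vertex
    that has no neighbour in it. *)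
Lemma two_sided_gap C : two_sided C -> first_independent E C -> gap C.
Proof.
move=> C2 /and3P[/andP[_ /forall_inP C_indep] C_first _].
have C_indep' u v : u \in C -> v \in C -> ~~ adj E u v.
  by move=> uC; apply: (forall_inP (C_indep u uC)).
have C_max : max_independent E C.
  case/orP: C_first => [/andP[]//|/existsP[s /existsP[u /andP[_ /eqP CE]]]].
  case/forallP/(_ (~~ s))/andP: (C2) => /finset.set0Pn[w].
  by rewrite CE !inE; case: (w) => ?; case: (s) => /=; rewrite andbF.
have [/andP[C1 _] /andP[C0 _]] := (forallP C2 true, forallP C2 false).
split.
- move=> a; apply/idP/forallP => [aC b|aC].
    by apply/implyP => bC; apply: (C_indep' (inl a) (inr b)).
  by apply: max_independentU1 => // -[a'|b] // bC; apply: (implyP (aC b)).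
- move=> b; apply/idP/forallP => [bC a|bC].
    by apply/implyP => aC; apply: (C_indep' (inl a) (inr b)).
  by apply: max_independentU1 => // -[a|b'] // aC; apply: (implyP (bC a)).
- by case/finset.set0Pn: C1 => -[a|b]; rewrite !inE => /andP[aC] // _; exists a.
- by case/finset.set0Pn: C0 => -[a|b]; rewrite !inE => /andP[aC] // _; exists b.
Qed.

Lemma nbhd_gapl C : gap C -> nbhd E (C :&: part true) = part false :\: C.
Proof.
move=> Cg; apply/finset.setP => -[a|b]; rewrite ?in_nbhdl ?in_nbhdr !inE ?andbF ?andbT.
  by apply/negbTE/existsPn => b; rewrite !inE andbF.
case: (Cg) => _ -> _ _; rewrite negb_forall; apply: eq_existsb => a.
by rewrite !inE andbT negb_imply negbK.
Qed.

Lemma nbhd_gapr C : gap C -> nbhd E (C :&: part false) = part true :\: C.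
Proof.
move=> Cg; apply/finset.setP => -[a|b]; rewrite ?in_nbhdl ?in_nbhdr !inE ?andbF ?andbT; last first.
  by apply/negbTE/existsPn => a; rewrite !inE andbF.
case: (Cg) => -> _ _ _; rewrite negb_forall; apply: eq_existsb => b.
by rewrite !inE andbT negb_imply negbK.
Qed.

Lemma pairing_gap (x : vec) C :
  pairing x (gap_vec C) =
  \sum_(v in part false :\: C) x v - \sum_(v in C :&: part true) x v.
Proof.
rewrite !sum_setV /pairing sum_V addrC.
rewrite [X in _ = X + _ - _]big_pred0 => [|a]; last by rewrite !inE andbF.
rewrite [X in _ = _ - (_ + X)]big_pred0 => [|b]; last by rewrite !inE andbF.
rewrite add0r addr0 -sumrN; congr (_ + _).
- rewrite big_mkcond [RHS]big_mkcond; apply: eq_bigr => b _.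
  by rewrite ffunE !inE andbT; case: (_ \in _); rewrite /= ?mulr1 ?mulr0.
- rewrite big_mkcond [RHS]big_mkcond; apply: eq_bigr => a _.
  by rewrite ffunE !inE andbT; case: (_ \in _); rewrite /= ?mulrN1 ?oppr0 ?mulr0.
Qed.

Lemma edge_cone_gap C : gap C -> edge_cone E (gap_vec C).
Proof.
move=> Cg; apply/edge_coneP => a b ab; rewrite edge_val_gap subr_ge0 ler_nat.
case aC: (inl a \in C) => //; case bC: (inr b \in C) => //.
by have := gap_indep Cg aC bC; rewrite ab.
Qed.

(** * Rays and faces for a graph with two full rows and two full columns *)

Section FullLines.
Variables (r1 r2 : U1) (c1 c2 : U2).
Hypotheses (r12 : r1 != r2) (c12 : c1 != c2).
Hypotheses (r1_full : forall b, E r1 b) (r2_full : forall b, E r2 b).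
Hypotheses (c1_full : forall a, E a c1) (c2_full : forall a, E a c2).

Lemma full_row_gap r C : (forall b, E r b) -> gap C -> inl r \notin C.
Proof.
move=> r_full Cg; apply/negP => rC; case: (Cg) => _ _ _ [b bC].
by have := gap_indep Cg rC bC; rewrite r_full.
Qed.

Lemma full_col_gap c C : (forall a, E a c) -> gap C -> inr c \notin C.
Proof.
move=> c_full Cg; apply/negP => cC; case: (Cg) => _ _ [a aC] _.
by have := gap_indep Cg aC cC; rewrite c_full.
Qed.

Lemma other_full_row i : exists2 r, r != i & forall b, E r b.
Proof.
have [<-|] := eqVneq r1 i; first by exists r2; rewrite // eq_sym.
by exists r1.
Qed.

Lemma other_full_col j : exists2 c, c != j & forall a, E a c.
Proof.
have [<-|] := eqVneq c1 j; first by exists c2; rewrite // eq_sym.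
by exists c1.
Qed.

(** A pair of equations, so that a vanishing edge value can be solved for either end. *)
Lemma edge_val0 (y : vec) a b : edge_val y a b = 0 ->
  (y (inl a) = - y (inr b)) * (y (inr b) = - y (inl a)).
Proof. by rewrite /edge_val; split; lra. Qed.

(** The edges on which [gap_vec C] vanishes form two pieces: rows outside [C] with columns in [C],
    joined through [r1], and rows in [C] with columns outside [C], joined through [c1]. So a vector
    vanishing on them is known, modulo [line_gen], from its value on the edge between [r1] and
    [c1]. *)
Lemma ray_generator_gap C : gap C -> ray_generator E C (gap_vec C).
Proof.
move=> Cg; have r1C := full_row_gap r1_full Cg; have c1C := full_col_gap c1_full Cg.
have face_true : dual_face E (C :&: part true) =
    cone_spanned (fun _ : 'I_1 => gap_vec C).
  apply: ray_dual_face; first exact: edge_cone_gap.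
  - move=> x xd; rewrite /hyperplane nbhd_gapl // pairing_gap => ->.
    by rewrite subrr.
  - move=> a b ab; rewrite edge_val_gap => /eqP; rewrite subr_eq0 eqr_nat => /eqP abC.
    by apply: hyperplane_edge; rewrite nbhd_gapl // !inE !andbT !andbF addn0 add0n abC.
  - move=> y yc y0.
    have y0' a b : E a b -> (inr b \notin C) = (inl a \in C) -> edge_val y a b = 0.
      by move=> ab abC; apply: y0; rewrite // edge_val_gap abC subrr.
    have yr b : inr b \in C -> y (inr b) = - y (inl r1).
      by move=> bC; rewrite (edge_val0 (y0' _ b (r1_full b) _)) // bC (negPf r1C).
    have yc1 a : inl a \in C -> y (inl a) = - y (inr c1).
      by move=> aC; rewrite (edge_val0 (y0' a _ (c1_full a) _)) // aC c1C.
    exists (edge_val y r1 c1); first exact: (edge_coneP E y).1.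
    apply: (@eqN_ext _ _ (y (inl r1))) => [a|b]; rewrite !ffunE /edge_val /GRing.scale /=.
    + case aC : (inl a \in C); first by rewrite yc1 //=; ring.
      have [b bC ab] := gap_row Cg (negbT aC).
      by rewrite (edge_val0 (y0' a b ab _)) ?(yr b) ?aC ?bC //=; ring.
    + case bC : (inr b \in C); first by rewrite yr //=; ring.
      have [a aC ab] := gap_col Cg (negbT bC).
      by rewrite (edge_val0 (y0' a b ab _)) ?(yc1 a) ?aC ?bC //=; ring.
split.
  apply: (@primitive_edge_val1 _ _ _ r1 c1).
    by move=> v; rewrite ffunE; case: v => v; rewrite ?rpredN ?rpred_nat.
  by rewrite edge_val_gap (negPf r1C) c1C subr0.
(* Both halves of [C] define the same facet, because row and column sums agree on the dual cone. *)
move=> [] _ //; rewrite -face_true.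
apply/funext => y; apply/propext; rewrite /dual_face.
suff HE x : dual_edge_cone E x ->
    hyperplane E (C :&: part true) x <-> hyperplane E (C :&: part false) x.
  by split=> -[yc y0]; split=> // x xd /(HE x xd); apply: y0.
move=> xd; rewrite /hyperplane nbhd_gapl // nbhd_gapr //.
have := sum_part_set true xd.
rewrite (big_setID C) [RHS](big_setID C) /= finset.setIC [part false :&: C]finset.setIC.
by split; lra.
Qed.


Lemma ray_generator_unitl i :
  ray_generator E (part true :\ inl i) (unit_vec (inl i)).
Proof.
have [r ri r_full] := other_full_row i.
apply: (@ray_generator_unit true (inl i) i c1) => //.
- by rewrite in_partl.
- apply/finset.setP => -[a|b]; rewrite ?in_nbhdl ?in_nbhdr !inE.
    by apply/negbTE/existsPn => b; rewrite !inE.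
  by apply/existsP; exists r; rewrite !inE r_full inl_eq ri.
- by rewrite edge_val_unitl eqxx.
move=> y yc y0.
have {}y0 a b : a != i -> E a b -> edge_val y a b = 0.
  by move=> /negPf ai ab; apply: y0; rewrite // edge_val_unitl ai.
have yb b : y (inr b) = - y (inl r) by rewrite (edge_val0 (y0 _ _ ri (r_full b))).
exists (edge_val y i c1); first exact: (edge_coneP E y).1.
apply: (@eqN_ext _ _ (y (inl r))) => [a|b]; rewrite !ffunE /edge_val /GRing.scale /=.
- rewrite inl_eq; case: eqVneq => [->|ai] /=; first by rewrite yb; ring.
  by rewrite (edge_val0 (y0 _ _ ai (c1_full a))) yb; ring.
- by rewrite yb; ring.
Qed.

Lemma ray_generator_unitr j :
  ray_generator E (part false :\ inr j) (unit_vec (inr j)).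
Proof.
have [c cj c_full] := other_full_col j.
apply: (@ray_generator_unit false (inr j) r1 j) => //.
- by rewrite in_partr.
- apply/finset.setP => -[a|b]; rewrite ?in_nbhdl ?in_nbhdr !inE.
    by apply/existsP; exists c; rewrite !inE c_full inr_eq cj.
  by apply/negbTE/existsPn => a; rewrite !inE.
- by rewrite edge_val_unitr eqxx.
move=> y yc y0.
have {}y0 a b : b != j -> E a b -> edge_val y a b = 0.
  by move=> /negPf bj ab; apply: y0; rewrite // edge_val_unitr bj.
have ya a : y (inl a) = - y (inr c) by rewrite (edge_val0 (y0 _ _ cj (c_full a))).
exists (edge_val y r1 j); first exact: (edge_coneP E y).1.
apply: (@eqN_ext _ _ (- y (inr c))) => [a|b]; rewrite !ffunE /edge_val /GRing.scale /=.
- by rewrite ya; ring.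
- rewrite inr_eq; case: eqVneq => [->|bj] /=; first by rewrite ya; ring.
  by rewrite (edge_val0 (y0 _ _ bj (r1_full b))) ya; ring.
Qed.

(** All rows but [i] meet a full column [c], all columns but [j] meet a full row [r]: the common
    tight edges leave only [i], [j] and one large component. *)
Lemma independent_face_opposite_sides i j :
  first_independent E (part true :\ inl i) ->
  first_independent E (part false :\ inr j) ->
  independent_face E [tuple part true :\ inl i; part false :\ inr j].
Proof.
move=> If Jf.
have [r ri r_full] := other_full_row i.
have [c cj c_full] := other_full_col j.
apply: (independent_face_pair If Jf (ray_generator_unitl i) (ray_generator_unitr j)).
- exact: edge_cone_unit.
- exact: edge_cone_unit.
- apply: (@span_dim_pair _ _ _ _ i c r j);
    by rewrite ?edge_val_unitl ?edge_val_unitr ?eqxx ?(negPf cj) ?(negPf ri).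
move=> y yc y0.
have {}y0 a b : a != i -> b != j -> E a b -> edge_val y a b = 0.
  move=> /negPf ai /negPf bj ab; apply: y0 => //.
    by rewrite edge_val_unitl ai.
  by rewrite edge_val_unitr bj.
exists (edge_val y i c), (edge_val y r j).
split; rewrite ?((edge_coneP E y).1 yc) //.
have yb b : b != j -> y (inr b) = - y (inl r).
  by move=> bj; rewrite (edge_val0 (y0 _ _ ri bj (r_full b))).
apply: (@eqN_ext _ _ (y (inl r))) => [a|b]; rewrite !ffunE /edge_val /GRing.scale /=.
- rewrite inl_eq; case: eqVneq => [->|ai] /=; first by rewrite (yb c) //; ring.
  by rewrite (edge_val0 (y0 _ _ ai cj (c_full a))) (yb c) //; ring.
- rewrite inr_eq; case: eqVneq => [->|bj] /=; first by ring.
  by rewrite (yb b) //; ring.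
Qed.

Section Nested.
Hypothesis nested : forall a a' b b', E a b -> E a' b' -> E a b' || E a' b.

(** Otherwise a row of [C] outside [C'] and a row of [C'] outside [C] have neighbours in [C'] and
    [C] respectively, and nestedness gives an edge inside [C] or inside [C']. *)
Lemma gap_chain C C' : gap C -> gap C' ->
  (forall a, inl a \in C -> inl a \in C') \/
  (forall a, inl a \in C' -> inl a \in C).
Proof.
move=> Cg Cg'.
have [CC'|] := boolP [forall a, (inl a \in C) ==> (inl a \in C')].
  by left=> a; apply/implyP/(forallP CC').
rewrite negb_forall => /existsP[a]; rewrite negb_imply => /andP[aC aC'].
right=> a' a'C'; apply: contraT => a'C.
have [b' b'C' ab'] := gap_row Cg' aC'.
have [b bC a'b] := gap_row Cg a'C.
have := nested ab' a'b.
by rewrite (negPf (gap_indep Cg aC bC)) (negPf (gap_indep Cg' a'C' b'C')).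
Qed.

Lemma gap_subr C C' : gap C -> gap C' ->
  (forall a, inl a \in C' -> inl a \in C) ->
  forall b, inr b \in C -> inr b \in C'.
Proof.
move=> Cg [_ Cr' _ _] C'C b bC; rewrite Cr'; apply/forallP => a; apply/implyP => /C'C aC.
exact: gap_indep Cg aC bC.
Qed.

(** The common tight edges form three pieces: one through [r1], one through [c1], and the rows of
    [C] outside [C'] with the columns of [C'] outside [C]. The last is connected by nestedness: any
    two of its rows have a common neighbour in it. *)
Lemma gap_gap_span C C' y : gap C -> gap C' -> C <> C' ->
  (forall a, inl a \in C' -> inl a \in C) ->
  edge_cone E y ->
  (forall a b, E a b -> edge_val (gap_vec C) a b = 0 ->
     edge_val (gap_vec C') a b = 0 -> edge_val y a b = 0) ->
  exists c d, [/\ 0 <= c, 0 <= d & eqN y (c *: gap_vec C + d *: gap_vec C')].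
Proof.
move=> Cg Cg' CC' C'C yc y0.
have CC'r := gap_subr Cg Cg' C'C.
have {}y0 a b : E a b -> (inr b \notin C) = (inl a \in C) ->
    (inr b \notin C') = (inl a \in C') -> edge_val y a b = 0.
  by move=> ab abC abC'; apply: y0; rewrite // edge_val_gap ?abC ?abC' subrr.
have r1C := full_row_gap r1_full Cg; have c1C := full_col_gap c1_full Cg.
have r1C' := full_row_gap r1_full Cg'; have c1C' := full_col_gap c1_full Cg'.
have [a0 a0C a0C'] := gap_properP Cg Cg' CC' C'C.
have yC b : inr b \in C -> y (inr b) = - y (inl r1).
  move=> bC; rewrite (edge_val0 (y0 r1 b (r1_full b) _ _)) //.
    by rewrite bC (negPf r1C).
  by rewrite CC'r // (negPf r1C').
have yC' a : inl a \in C' -> y (inl a) = - y (inr c1).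
  move=> aC; rewrite (edge_val0 (y0 a c1 (c1_full a) _ _)) //.
    by rewrite C'C // c1C.
  by rewrite aC c1C'.
have y_step b a : inl a \in C -> inl a \notin C' -> inr b \notin C ->
    inr b \in C' -> E a b -> y (inr b) = - y (inl a).
  move=> aC aC' bC bC' ab; rewrite (edge_val0 (y0 a b ab _ _)) //.
    by rewrite bC aC.
  by rewrite bC' (negPf aC').
have step_nbr a : inl a \in C -> inl a \notin C' ->
    exists2 b, E a b & inr b \notin C /\ inr b \in C'.
  move=> aC aC'; have [b bC' ab] := gap_row Cg' aC'; exists b => //; split=> //.
  by apply/negP => bC; have := gap_indep Cg aC bC; rewrite ab.
have y_row a : inl a \in C -> inl a \notin C' -> y (inl a) = y (inl a0).
  move=> aC aC'; have [b ab [bC bC']] := step_nbr a aC aC'.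
  have [b' a0b' [b'C b'C']] := step_nbr a0 a0C a0C'.
  apply: oppr_inj; case/orP: (nested ab a0b') => [ab'|a0b].
    by rewrite -(y_step b') // -(y_step b' a0).
  by rewrite -(y_step b) // -(y_step b a0).
have y_col b : inr b \notin C -> inr b \in C' -> y (inr b) = - y (inl a0).
  move=> bC bC'; have [a aC ab] := gap_col Cg bC.
  have aC' : inl a \notin C'.
    by apply/negP => aC'; have := gap_indep Cg' aC' bC'; rewrite ab.
  by rewrite (y_step b a) // y_row.
have [b0 a0b0 [b0C b0C']] := step_nbr a0 a0C a0C'.
(* On (r1, b0) the generators have values 1 and 0, on (a0, c1) values 0 and 1. *)
exists (edge_val y r1 b0), (edge_val y a0 c1).
split; rewrite ?((edge_coneP E y).1 yc) //.
apply: (@eqN_ext _ _ (y (inl r1))) => [a|b]; rewrite !ffunE /edge_val /GRing.scale /=.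
- rewrite (y_col b0) //; case aC' : (inl a \in C').
    by rewrite C'C // (yC' a) //=; ring.
  case aC : (inl a \in C); first by rewrite (y_row a) ?aC' //=; ring.
  have [b bC ab] := gap_row Cg (negbT aC).
  rewrite (edge_val0 (y0 a b ab _ _)) ?bC ?CC'r ?aC ?aC' // (yC b) //=; ring.
- rewrite (y_col b0) //; case bC : (inr b \in C).
    by rewrite CC'r // (yC b) //=; ring.
  case bC' : (inr b \in C'); first by rewrite (y_col b) ?bC //=; ring.
  have [a aC' ab] := gap_col Cg' (negbT bC').
  rewrite (edge_val0 (y0 a b ab _ _)) ?aC' ?C'C ?bC ?bC' // (yC' a) //=; ring.
Qed.

Lemma gap_gap_span_dim C C' : gap C -> gap C' -> C <> C' ->
  (forall a, inl a \in C' -> inl a \in C) ->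
  span_dim (pair_vec (gap_vec C) (gap_vec C')) = 2%N /\
  span_dim (pair_vec (gap_vec C') (gap_vec C)) = 2%N.
Proof.
move=> Cg Cg' CC' C'C; have CC'r := gap_subr Cg Cg' C'C.
have r1C := full_row_gap r1_full Cg; have c1C := full_col_gap c1_full Cg.
have r1C' := full_row_gap r1_full Cg'; have c1C' := full_col_gap c1_full Cg'.
have [a0 a0C a0C'] := gap_properP Cg Cg' CC' C'C.
have [b0 b0C' a0b0] := gap_row Cg' a0C'.
have b0C : inr b0 \notin C.
  by apply/negP => bC; have := gap_indep Cg a0C bC; rewrite a0b0.
split; [apply: (@span_dim_pair _ _ _ _ r1 b0 a0 c1) |
        apply: (@span_dim_pair _ _ _ _ a0 c1 r1 b0)];
  by rewrite edge_val_gap ?(negPf r1C) ?(negPf r1C') ?c1C ?c1C'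
    ?a0C ?(negPf a0C') ?b0C ?b0C' //= ?subrr ?subr0 ?oner_eq0.
Qed.

Lemma independent_face_gap_gap C C' :
  first_independent E C -> first_independent E C' ->
  gap C -> gap C' -> C <> C' ->
  independent_face E [tuple C; C'].
Proof.
move=> Cf Cf' Cg Cg' CC'.
apply: (independent_face_pair Cf Cf' (ray_generator_gap Cg) (ray_generator_gap Cg')).
- exact: edge_cone_gap.
- exact: edge_cone_gap.
- have [sub|sub] := gap_chain Cg' Cg.
    exact: (gap_gap_span_dim Cg Cg' CC' sub).1.
  exact: (gap_gap_span_dim Cg' Cg (nesym CC') sub).2.
move=> y yc y0.
have [sub|sub] := gap_chain Cg' Cg.
  exact: gap_gap_span.
have [|c [d [c0 d0 yE]]] := gap_gap_span Cg' Cg (nesym CC') sub yc.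
  by move=> a b ab *; apply: y0.
by exists d, c; split; rewrite // addrC.
Qed.

End Nested.

(** The edges of the associated subgraph are those on which [gap_vec C] vanishes, so the pieces are
    again those of [c1] and [r1]. *)
Lemma gap_components C : gap C -> ncomponents (assoc_subgraph E C) = 2%N.
Proof.
move=> Cg; have r1C := full_row_gap r1_full Cg; have c1C := full_col_gap c1_full Cg.
have -> : assoc_subgraph E C =
    induced2 E ((C :&: part true) :|: (part false :\: C))
               ((C :&: part false) :|: (part true :\: C)).
  rewrite /assoc_subgraph nbhd_gapl // nbhd_gapr //; case: (Cg) => _ _ [a aC] [b bC].
  case: ifP => [/fintype.subsetP/(_ (inr b) bC)|_]; first by rewrite in_partr.
  by case: ifP => [/fintype.subsetP/(_ (inl a) aC)|_] //; rewrite in_partl.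
set S := _ :|: _; set S' := _ :|: _; set e := induced2 E S S'.
have SE v : (v \in S') = (v \notin S).
  by rewrite !inE; case: v => v /=; case: (_ \in C).
have e_sym : connect_sym e.
  apply: sym_connect_sym => u v; rewrite /e /induced2 adj_sym.
  by rewrite [(u \in S) && _]andbC [(u \in S') && _]andbC.
have S_closed : closed e (mem S).
  by move=> u v /andP[_]; rewrite !SE => /orP[/andP[-> ->]|/andP[/negPf-> /negPf->]].
have eE a b : E a b -> (inl a \in C) = (inr b \notin C) -> e (inl a) (inr b).
  by rewrite /e /induced2 /= !inE => -> ->; case: (_ \in C).
have to_c1 v : v \in S -> connect e v (inr c1).
  rewrite !inE; case: v => [a|b] /=; rewrite ?(andbF, andbT, orbF, orFb) => vC.
    by apply/connect1/eE; rewrite // vC c1C.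
  have [a aC ab] := gap_col Cg vC.
  apply: (@connect_trans _ _ (inl a)).
    by rewrite e_sym; apply/connect1/eE; rewrite // aC vC.
  by apply/connect1/eE; rewrite // aC c1C.
have to_r1 v : v \notin S -> connect e v (inl r1).
  rewrite -SE !inE; case: v => [a|b] /=; rewrite ?(andbF, andbT, orbF, orFb) => vC.
    have [b bC ab] := gap_row Cg vC.
    apply: (@connect_trans _ _ (inr b)).
      by apply/connect1/eE; rewrite // bC (negPf vC).
    by rewrite e_sym; apply/connect1/eE; rewrite // bC (negPf r1C).
  by rewrite e_sym; apply/connect1/eE; rewrite // vC (negPf r1C).
have c1S : inr c1 \in S by rewrite !inE c1C andbF.
have r1S : inl r1 \notin S by rewrite -SE !inE r1C andbF.
have c1r1 : connect e (inr c1) (inl r1) = false.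
  by apply/negP => /(closed_connect S_closed); rewrite /= c1S (negPf r1S).
have all_comp : [set: V] =i closure e (pred2 (inr c1) (inl r1)).
  move=> v; rewrite inE; apply/esym/existsP.
  have [vS|vS] := boolP (v \in S); [exists (inr c1)|exists (inl r1)]; apply/andP; split.
  - exact: to_c1.
  - by rewrite !inE eqxx.
  - exact: to_r1.
  - by rewrite !inE eqxx orbT.
by rewrite /ncomponents (eq_n_comp_r all_comp) n_comp_closure2 // c1r1.
Qed.

(** Serves to produce the first independent sets whose existence claims (3) and (4) assert. *)
Lemma gap_first_independent C : gap C -> two_sided C /\ first_independent E C.
Proof.
move=> Cg; have r1C := full_row_gap r1_full Cg; have c1C := full_col_gap c1_full Cg.
case: (Cg) => C1 C2 [a aC] [b bC].
have C_two : two_sided C.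
  apply/forallP => -[]; rewrite finset.properEneq finset.subsetIr andbT.
    apply/andP; split; first by apply/finset.set0Pn; exists (inl a); rewrite !inE aC.
    by apply/negP => /eqP/finset.setP/(_ (inl r1)); rewrite !inE (negPf r1C).
  apply/andP; split; first by apply/finset.set0Pn; exists (inr b); rewrite !inE bC.
  by apply/negP => /eqP/finset.setP/(_ (inr c1)); rewrite !inE (negPf c1C).
have C_indep : independent E C.
  apply/andP; split; first by apply/finset.set0Pn; exists (inl a).
  apply/forall_inP => -[a'|b'] uC; apply/forall_inP => -[a''|b''] vC //.
    exact: gap_indep Cg uC vC.
  exact: gap_indep Cg vC uC.
split=> //; rewrite /first_independent C_indep C_two gap_components // eqxx andbT /=.
apply/orP; left; rewrite /max_independent C_indep /=; apply/andP; split.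
  rewrite finset.properEneq finset.subsetT andbT; apply/negP => /eqP CT.
  by rewrite CT inE in r1C.
apply/forallP => B; apply/implyP => /andP[/andP[_ /forall_inP B_indep] /fintype.subsetP CB].
rewrite finset.eqEsubset; apply/andP; split; last exact/fintype.subsetP.
apply/fintype.subsetP => -[a'|b'] vB.
  rewrite C1; apply/forallP => b'; apply/implyP => /CB b'B.
  exact: (forall_inP (B_indep _ vB) _ b'B).
rewrite C2; apply/forallP => a'; apply/implyP => /CB a'B.
exact: (forall_inP (B_indep _ vB) _ a'B).
Qed.

(** Every edge at [b] ends at [i] or outside [C], so one of the generators is 1 on it, and
    subtracting f_b from their sum stays in the cone. *)
Lemma not_independent_face_row_gap i C b : gap C -> inl i \in C -> inr b \notin C ->
  (forall a, inl a \in C -> E a b -> a = i) ->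
  ~ independent_face E [tuple part true :\ inl i; C].
Proof.
move=> Cg iC bC b_nbr.
have [r ri r_full] := other_full_row i; have [c cb c_full] := other_full_col b.
have r1C := full_row_gap r1_full Cg; have cC := full_col_gap c_full Cg.
apply: (@not_independent_face_pair _ _ _ _ _ (unit_vec (inl i)) (gap_vec C)
  (unit_vec (inr b))).
- by apply/finset.set0Pn; exists (inl r); rewrite !inE inl_eq ri.
- by apply/finset.set0Pn; exists (inl i).
- exact: ray_generator_unitl.
- exact: ray_generator_gap.
- exact: edge_cone_unit.
- exact: edge_cone_gap.
- exact: edge_cone_unit.
- apply/edge_coneP => a b' ab.
  rewrite -scaleN1r !edge_valD edge_valZ edge_val_unitl edge_val_unitr.
  have := (edge_coneP E _).1 (edge_cone_gap Cg) a b' ab.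
  rewrite edge_val_gap; have [b'b|_] := eqVneq b' b; last first.
    by move=> g0; rewrite mulr0 addr0 addr_ge0.
  rewrite b'b bC in ab *; have [_|ai] := eqVneq a i; first by move=> ?; lra.
  case aC : (inl a \in C); first by rewrite (b_nbr a) ?eqxx // in ai.
  by move=> _ /=; lra.
(* The columns [b] and [c] are both outside [C], so every combination has equal coordinates there,
   unlike f_b. *)
move=> e f [g] /ffunP wE.
have := wE (inl r1); have := wE (inr c); have := wE (inr b).
rewrite !ffunE /GRing.scale /= bC cC (negPf r1C) !inr_eq (negPf cb) inl_eq eqxx /=.
have -> : (r1 == i) = false by apply: contraNF r1C => /eqP ->.
by rewrite /=; lra.
Qed.

(** By the last hypothesis, leaving out the edges at [i] splits off [i] alone from the two pieces of
    [gap_vec C], which stay joined through a full row [r] and through [c1]. *)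
Lemma independent_face_row_gap i C :
  first_independent E (part true :\ inl i) -> first_independent E C -> gap C ->
  (inl i \in C -> forall b, inr b \notin C ->
    exists a, [/\ inl a \in C, a != i & E a b]) ->
  independent_face E [tuple part true :\ inl i; C].
Proof.
move=> If Cf Cg nbr.
have [r ri r_full] := other_full_row i.
have rC := full_row_gap r_full Cg; have c1C := full_col_gap c1_full Cg.
have [a1 a1C a1i] : exists2 a, inl a \in C & a != i.
  have [iC|iC] := boolP (inl i \in C).
    by have [a [aC ai _]] := nbr iC c1 c1C; exists a.
  by case: (Cg) => _ _ [a aC] _; exists a => //; apply: contraNneq iC => <-.
apply: (independent_face_pair If Cf (ray_generator_unitl i) (ray_generator_gap Cg)).
- exact: edge_cone_unit.
- exact: edge_cone_gap.
- have [iC|iC] := boolP (inl i \in C).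
    by apply: (@span_dim_pair _ _ _ _ i c1 r c1);
      rewrite ?edge_val_unitl ?edge_val_gap ?eqxx ?c1C ?iC ?(negPf rC) ?(negPf ri) /=
        ?subrr ?subr0 ?oner_eq0.
  have [b bC ib] := gap_row Cg iC.
  by apply: (@span_dim_pair _ _ _ _ i b r c1);
    rewrite ?edge_val_unitl ?edge_val_gap ?eqxx ?c1C ?bC ?(negPf iC) ?(negPf rC)
      ?(negPf ri) /= ?subrr ?subr0 ?oner_eq0.
move=> y yc y0.
have {}y0 a b : E a b -> a != i -> (inr b \notin C) = (inl a \in C) ->
    edge_val y a b = 0.
  move=> ab /negPf ai abC; apply: y0; rewrite ?edge_val_unitl ?ai //.
  by rewrite edge_val_gap abC subrr.
have yr b : inr b \in C -> y (inr b) = - y (inl r).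
  by move=> bC; case: (edge_val0 (y0 r b (r_full b) ri _)); rewrite // bC (negPf rC).
have yc1 a : inl a \in C -> a != i -> y (inl a) = - y (inr c1).
  by move=> aC ai; case: (edge_val0 (y0 a c1 (c1_full a) ai _)); rewrite // aC c1C.
have yrow a : inl a \notin C -> a != i -> y (inl a) = y (inl r).
  move=> aC ai; have [b bC ab] := gap_row Cg aC.
  case: (edge_val0 (y0 a b ab ai _)) => [|-> _]; first by rewrite bC (negPf aC).
  by rewrite (yr b) // opprK.
have ycol b : inr b \notin C -> y (inr b) = y (inr c1).
  move=> bC; have [a [aC ai ab]] : exists a, [/\ inl a \in C, a != i & E a b].
    have [iC|iC] := boolP (inl i \in C); first exact: nbr.
    have [a aC ab] := gap_col Cg bC; exists a; split=> //.
    by apply: contraNneq iC => <-.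
  case: (edge_val0 (y0 a b ab ai _)) => [|_ ->]; first by rewrite bC aC.
  by rewrite (yc1 a) // opprK.
(* This is the value of [y] on an edge at [i] on which [gap_vec C] vanishes: to [c1] if [i] is in
   [C], otherwise to a column in [C]. *)
have i_ge0 : 0 <= y (inl i) + (if inl i \in C then y (inr c1) else - y (inl r)).
  case: ifPn => iC; first exact: (edge_coneP E y).1 yc i c1 (c1_full i).
  have [b bC ib] := gap_row Cg iC.
  by rewrite -(yr b) //; apply: (edge_coneP E y).1 yc i b ib.
exists (y (inl i) + (if inl i \in C then y (inr c1) else - y (inl r))).
exists (edge_val y r c1); split=> //; first exact: (edge_coneP E y).1 yc r c1 (r_full c1).
apply: (@eqN_ext _ _ (y (inl r))) => [a|b]; rewrite !ffunE /edge_val /GRing.scale /=.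
- rewrite inl_eq; have [->|ai] := eqVneq a i; first by case: (inl i \in C) => /=; ring.
  case aC : (inl a \in C) => /=; first by rewrite (yc1 a) //; ring.
  by rewrite (yrow a) ?aC //; ring.
- case bC : (inr b \in C) => /=; first by rewrite (yr b) //; ring.
  by rewrite (ycol b) ?bC //; ring.
Qed.

(** The new columns are all those with no neighbour among the remaining rows. They include [b],
    which keeps [i] out, and the columns of [C], which keep out the rows outside [C]. *)
Lemma gap_remove_row i C b : gap C -> inl i \in C -> inr b \notin C ->
  (forall a, inl a \in C -> E a b -> a = i) -> C :&: part true != [set inl i] ->
  gap (((C :&: part true) :\ inl i) :|:
    [set v | if v is inr b' then
       [forall a, ((inl a \in C) && (a != i)) ==> ~~ E a b'] else false]).
Proof.
move=> Cg iC bC b_nbr C1; set D := [set v | _] : {set V}; set C' := _ :|: D.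
have C'l a : (inl a \in C') = (inl a \in C) && (a != i).
  by rewrite !inE inl_eq orbF andbT andbC.
have C'r b' : (inr b' \in C') = [forall a, (inl a \in C') ==> ~~ E a b'].
  have -> : (inr b' \in C') =
      [forall a, ((inl a \in C) && (a != i)) ==> ~~ E a b'].
    by rewrite !inE !andbF.
  by apply: eq_forallb => a; rewrite C'l.
have bC' : inr b \in C'.
  rewrite C'r; apply/forallP => a; rewrite C'l; apply/implyP => /andP[aC].
  by apply: contraNN => ab; apply/eqP/b_nbr.
have ib : E i b by have [a aC ab] := gap_col Cg bC; rewrite -(b_nbr a aC ab).
split=> //; last by exists b.
- move=> a; apply/idP/forallP => [aC' b'|a_nbr].
    by apply/implyP; rewrite C'r => /forallP/(_ a)/implyP; apply.
  have ai : a != i.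
    by apply/negP => /eqP ai; have := a_nbr b; rewrite bC' ai ib.
  rewrite C'l ai andbT; apply: contraT => aC; have [b' b'C ab'] := gap_row Cg aC.
  have := a_nbr b'; rewrite ab' implybF => /negP[]; rewrite C'r.
  apply/forallP => a'; apply/implyP; rewrite C'l => /andP[a'C _].
  exact: gap_indep Cg a'C b'C.
- have [/existsP[a aC']|none] := boolP [exists a, inl a \in C']; first by exists a.
  case/eqP: C1; apply/finset.setP => -[a|b']; last by rewrite !inE andbF.
  rewrite !inE andbT inl_eq; apply/idP/eqP => [aC|-> //]; apply/eqP.
  by apply: contraNT none => ai; apply/existsP; exists a; rewrite C'l aC.
Qed.

Section ThreeRows.
Variable r3 : U1.
Hypotheses (r31 : r3 != r1) (r32 : r3 != r2).

(** The full rows [r1] and [r2] meet [b], so they are [i] and [i'] in some order, and [r3] does not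
    meet [b]. *)
Lemma two_row_nbhd i i' b c : (forall a, E a b -> (a == i) || (a == i')) ->
  (forall a, E a c) -> [/\ i != i' , r3 != i, r3 != i' & c != b].
Proof.
move=> b_nbr c_full.
have [ii' r3i r3i'] : [/\ i != i', r3 != i & r3 != i'].
  have := b_nbr r1 (r1_full b); have := b_nbr r2 (r2_full b).
  case/orP => /eqP r2E; case/orP => /eqP r1E.
  - by move: r12; rewrite r1E r2E eqxx.
  - by rewrite -r1E -r2E r31 r32 eq_sym r12.
  - by rewrite -r1E -r2E r31 r32 r12.
  - by move: r12; rewrite r1E r2E eqxx.
split=> //; apply/negP => /eqP cb.
by have := b_nbr r3; rewrite -cb c_full (negPf r3i) (negPf r3i') => /(_ isT).
Qed.

(** C2 collects the columns with all neighbours among [i] and [i']. The row [r3] makes the row half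
    nonempty and keeps [c1] and [c2] out of C2, whence |C2| <= n - 2. *)
Lemma two_rows_gap i i' b : (forall a, E a b -> (a == i) || (a == i')) ->
  exists C2 : {set V}, [/\ C2 \subset part false, inr c1 \notin C2,
    inr c2 \notin C2 & gap ((part true :\: [set inl i; inl i']) :|: C2)].
Proof.
move=> b_nbr.
have [_ r3i r3i' _] := two_row_nbhd b_nbr c1_full.
exists [set v | if v is inr b' then
   [forall a, E a b' ==> ((a == i) || (a == i'))] else false].
have full_out c : (forall a, E a c) ->
    [forall a, E a c ==> ((a == i) || (a == i'))] = false.
  move=> c_full; apply/negbTE/forallPn; exists r3.
  by rewrite c_full (negPf r3i) (negPf r3i').
split; rewrite ?inE ?full_out //.
  by apply/fintype.subsetP => -[a|b']; rewrite !inE.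
set D := [set v | _] : {set V}; set C := _ :|: D.
have Cl a : (inl a \in C) = (a != i) && (a != i').
  by rewrite !inE !inl_eq orbF andbT negb_or.
have Cr b' : (inr b' \in C) = [forall a, E a b' ==> ((a == i) || (a == i'))].
  by rewrite !inE !andbF.
have bC : inr b \in C by rewrite Cr; apply/forallP => a; apply/implyP/b_nbr.
split=> [a|b'||]; last by exists b.
- rewrite Cl; apply/idP/forallP => [/andP[ai ai'] b'|/(_ b)].
    apply/implyP; rewrite Cr => /forallP/(_ a); rewrite (negPf ai) (negPf ai').
    by rewrite implybF.
  rewrite bC /=; apply: contraNT; rewrite negb_and !negbK => aii'.
  have := b_nbr r1 (r1_full b); have := b_nbr r2 (r2_full b).
  case/orP: aii' => /eqP ->.
    by move=> /orP[/eqP <- //|/eqP r2E] /orP[/eqP <- //|/eqP r1E]; move: r12; rewrite r1E r2E eqxx.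
  by move=> /orP[/eqP r2E|/eqP <- //] /orP[/eqP r1E|/eqP <- //]; move: r12; rewrite r1E r2E eqxx.
- rewrite Cr; apply: eq_forallb => a; rewrite Cl -negb_or.
  by case: (E a b'); case: (_ || _).
- by exists r3; rewrite Cl r3i.
Qed.

Lemma independent_face_same_side i i' : i != i' ->
  first_independent E (part true :\ inl i) ->
  first_independent E (part true :\ inl i') ->
  (forall b, exists a, [/\ E a b, a != i & a != i']) ->
  independent_face E [tuple part true :\ inl i; part true :\ inl i'].
Proof.
move=> ii' If If' nbr.
apply: (independent_face_pair If If' (ray_generator_unitl i) (ray_generator_unitl i')).
- exact: edge_cone_unit.
- exact: edge_cone_unit.
- apply: (@span_dim_pair _ _ _ _ i c1 i' c1);
    by rewrite ?edge_val_unitl ?eqxx ?[i' == i]eq_sym ?(negPf ii').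
move=> y yc y0.
have {}y0 a b : a != i -> a != i' -> E a b -> edge_val y a b = 0.
  move=> /negPf ai /negPf ai' ab; apply: y0 => //.
    by rewrite edge_val_unitl ai.
  by rewrite edge_val_unitl ai'.
have ya a : a != i -> a != i' -> y (inl a) = - y (inr c1).
  by move=> ai ai'; have /edge_val0[] := y0 a c1 ai ai' (c1_full a).
exists (edge_val y i c1), (edge_val y i' c1).
split; rewrite ?((edge_coneP E y).1 yc) //.
apply: (@eqN_ext _ _ (- y (inr c1))) => [a|b]; rewrite !ffunE /edge_val /GRing.scale /=.
- rewrite !inl_eq; case: eqVneq => [->|ai] /=; first by rewrite (negPf ii') /=; ring.
  by case: eqVneq => [->|ai'] /=; [|rewrite ya //]; ring.
- have [a [ab ai ai']] := nbr b.
  by rewrite (edge_val0 (y0 a b ai ai' ab)) ya //; ring.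
Qed.

Lemma not_independent_face_same_side i i' b :
  (forall a, E a b -> (a == i) || (a == i')) ->
  ~ independent_face E [tuple part true :\ inl i; part true :\ inl i'].
Proof.
move=> b_nbr; have [ii' r3i r3i' cb] := two_row_nbhd b_nbr c1_full.
apply: (@not_independent_face_pair _ _ _ _ _ (unit_vec (inl i)) (unit_vec (inl i'))
  (unit_vec (inr b))).
- by apply/finset.set0Pn; exists (inl r3); rewrite !inE inl_eq r3i.
- by apply/finset.set0Pn; exists (inl r3); rewrite !inE inl_eq r3i'.
- exact: ray_generator_unitl.
- exact: ray_generator_unitl.
- exact: edge_cone_unit.
- exact: edge_cone_unit.
- exact: edge_cone_unit.
- apply/edge_coneP => a b' ab.
  rewrite -scaleN1r !edge_valD edge_valZ !edge_val_unitl edge_val_unitr.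
  have [b'b|_] := eqVneq b' b; last by rewrite mulr0 addr0 addr_ge0 ?ler0n.
  rewrite b'b in ab; case/orP: (b_nbr a ab) => /eqP ->; rewrite ?eqxx.
    by rewrite addrAC mulr1 subrr add0r ler0n.
  by rewrite mulr1 addrK ler0n.
move=> e f [g] /ffunP wE; have := wE (inr c1); have := wE (inr b).
by rewrite !ffunE /GRing.scale /= inr_eq eqxx inr_eq (negPf cb) /=; lra.
Qed.

Local Notation P1 := (part true : {set V}).
Local Notation P2 := (part false : {set V}).

(** Both sides express that some column has all its neighbours among [i] and [i']. *)
Lemma same_side_faces i i' : i <> i' ->
  first_independent E (P1 :\ inl i) -> first_independent E (P1 :\ inl i') ->
  (~ independent_face E [tuple P1 :\ inl i; P1 :\ inl i'] <->
   exists C2 : {set V},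
     [/\ C2 \proper P2, (#|C2| + 2 <= #|P2|)%N,
         two_sided ((P1 :\: [set inl i; inl i']) :|: C2)
       & first_independent E ((P1 :\: [set inl i; inl i']) :|: C2)]).
Proof.
move=> /eqP ii' If If'; split=> [not_face|[C2 [C2P _ C_two C_first]]].
  have [/existsP[b /forallP b_nbr]|none] :=
    boolP [exists b, forall a, E a b ==> ((a == i) || (a == i'))].
    have b_nbr' a : E a b -> (a == i) || (a == i') by apply/implyP.
    have [C2 [C2P c1C2 c2C2 Cg]] := two_rows_gap b_nbr'.
    have [C_two C_first] := gap_first_independent Cg.
    exists C2; split=> //.
      rewrite finset.properEneq C2P andbT; apply/eqP => C2E.
      by rewrite C2E !inE in c1C2.
    have <- : #|C2 :|: [set inr c1; inr c2]| = (#|C2| + 2)%N.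
      rewrite cardsU cards2 (_ : (inr c1 != inr c2 :> V)) //.
      rewrite (_ : C2 :&: _ = finset.set0) ?cards0 ?subn0 //.
      apply/finset.setP => v; rewrite !inE; apply/negP => /andP[vC2].
      by case/orP => /eqP vE; rewrite vE ?(negPf c1C2) ?(negPf c2C2) in vC2.
    apply/subset_leq_card/fintype.subsetP => v /finset.setUP[/(fintype.subsetP C2P)//|].
    by rewrite !inE => /orP[] /eqP ->.
  case: not_face; apply: (independent_face_same_side ii' If If') => b.
  move: none; rewrite negb_exists => /forallP/(_ b); rewrite negb_forall.
  case/existsP => a; rewrite negb_imply negb_or => /and3P[ab ai ai'].
  by exists a; split.
have Cg := two_sided_gap C_two C_first; case: (Cg) => _ _ _ [b bC].
apply: (@not_independent_face_same_side i i' b) => a ab.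
have : inl a \notin (P1 :\: [set inl i; inl i']) :|: C2.
  by apply/negP => aC; have := gap_indep Cg aC bC; rewrite ab.
by rewrite !inE !inl_eq andbT negb_or negbK => /andP[].
Qed.

(** Both sides express that [i] is in [C] and is the only neighbour in [C] of some column [b]
    outside [C]. Conversely to [gap_remove_row], [b] is [c1] if C_1 = {i}, and otherwise a neighbour
    of [i] in [C']. *)
Lemma row_gap_faces i C : first_independent E (P1 :\ inl i) ->
  two_sided C -> first_independent E C ->
  (~ independent_face E [tuple P1 :\ inl i; C] <->
   C :&: P1 = [set inl i] \/
   exists C' : {set V},
     [/\ two_sided C', first_independent E C', C' :&: P1 \subset C :&: P1
       & (C :&: P1) :\: (C' :&: P1) = [set inl i]]).
Proof.
move=> If C_two Cf; have Cg := two_sided_gap C_two Cf; split.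
  move=> not_face.
  have [/andP[iC /existsP[b /andP[bC /forallP b_nbr]]]|none] :=
    boolP ((inl i \in C) && [exists b, (inr b \notin C) &&
      [forall a, (inl a \in C) ==> E a b ==> (a == i)]]).
    have {}b_nbr a : inl a \in C -> E a b -> a = i.
      by move=> aC ab; apply/eqP; apply: (implyP (implyP (b_nbr a) aC)).
    have [->|C1] := eqVneq (C :&: P1) [set inl i]; first by left.
    right; have Cg' := gap_remove_row Cg iC bC b_nbr C1.
    have [C'_two C'_first] := gap_first_independent Cg'.
    set C' := _ :|: _ in Cg' C'_two C'_first *.
    have C'E : C' :&: P1 = (C :&: P1) :\ inl i.
      by apply/finset.setP => -[a|b']; rewrite !inE ?andbF ?orbF ?andbT.
    exists C'; split; rewrite // C'E ?finset.subsetDl //.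
    by rewrite finset.setDDr finset.setDv finset.set0U; apply/finset.setIidPr;
      rewrite finset.sub1set !inE iC.
  case: not_face; apply: (independent_face_row_gap If Cf Cg) => iC b bC.
  move: none; rewrite iC negb_exists => /forallP/(_ b); rewrite bC negb_forall.
  case/existsP => a; rewrite !negb_imply => /and3P[aC ab ai].
  by exists a; split.
case=> [C1|[C' [C'_two C'_first _ CC']]].
  have iC : inl i \in C by have := set11 (inl i : V); rewrite -C1 inE => /andP[].
  apply: (not_independent_face_row_gap Cg iC (full_col_gap c1_full Cg)).
  move=> a aC _; have : inl a \in C :&: P1 by rewrite !inE aC.
  by rewrite C1 inE => /eqP[].
have Cg' := two_sided_gap C'_two C'_first.
have [iC' iC] : inl i \notin C' /\ inl i \in C.
  by have := set11 (inl i : V); rewrite -CC' !inE !andbT => /andP[].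
have [b bC' ib] := gap_row Cg' iC'.
have bC : inr b \notin C.
  by apply/negP => bC; have := gap_indep Cg iC bC; rewrite ib.
apply: (not_independent_face_row_gap Cg iC bC).
move=> a aC ab; have aC' : inl a \notin C'.
  by apply/negP => aC'; have := gap_indep Cg' aC' bC'; rewrite ab.
have : inl a \in (C :&: P1) :\: (C' :&: P1) by rewrite !inE !andbT aC aC'.
by rewrite CC' inE => /eqP[].
Qed.

End ThreeRows.
End FullLines.
End Ferrers.

(** * The dimension of the torus *)

Section AlgebraicDependence.
Variables (F : fieldType) (n : nat).

Lemma msizeX_lt (p : {mpoly F[n]}) e k :
  (msize p < e)%N -> (msize (p ^+ k) < e * k + 2)%N.
Proof.
move=> pe; elim: k => [|k IH]; first by rewrite expr0 msize1 muln0.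
by rewrite exprS mulnS; have := msizeM_le p (p ^+ k); lia.
Qed.

Lemma msize_prod_lt (I : finType) (f : I -> {mpoly F[n]}) (e : nat) :
  (forall i, msize (f i) < e)%N -> (msize (\prod_i f i) < #|I| * e + 2)%N.
Proof.
move=> fe; rewrite -sum_nat_const.
apply: (big_rec2 (fun (p : {mpoly F[n]}) k => msize p < k + 2)%N).
  by rewrite msize1.
by move=> i p k _ pk; have := msizeM_le (f i) p; have := fe i; lia.
Qed.

Lemma card_bmultinom K : (#|{: 'X_{1..n < K}}| <= K ^ n)%N.
Proof.
have mK (m : 'X_{1..n < K}) i : (m i < K)%N.
  by apply: leq_ltn_trans (bmdeg m); rewrite mdegE (bigD1 i) //= leq_addr.
pose f (m : 'X_{1..n < K}) : {ffun 'I_n -> 'I_K} := [ffun i => Ordinal (mK m i)].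
have f_inj : injective f.
  move=> m m' /ffunP mm'; apply/val_inj/mnmP => i.
  by have := mm' i; rewrite !ffunE => /(congr1 val).
by have := leq_card f f_inj; rewrite card_ffun !card_ord.
Qed.

(* The products of powers of the [p i] with exponents less than [M] outnumber
   the monomials occurring in them when [M] is large. *)
Lemma algebraic_dependence d (p : 'I_d -> {mpoly F[n]}) : (n < d)%N ->
  exists M (q : {ffun 'I_d -> 'I_M} -> F),
    (exists al, q al != 0) /\
    \sum_al q al *: \prod_i p i ^+ al i = 0.
Proof.
move=> nd; pose e := (\max_i msize (p i)).+1.
have pe i : (msize (p i) < e)%N by rewrite ltnS (leq_bigmax i).
(* All products have [msize] below [K], which is linear in [M]. There are at most K^n = c^n M^n <
   M^(n+1) <= M^d monomials, since c^n < M. *)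
pose c := (d * (e + 2) + 2)%N; pose M := (c ^ n).+1; pose K := (c * M)%N.
have prod_lt (al : {ffun 'I_d -> 'I_M}) : (msize (\prod_i p i ^+ al i) < K)%N.
  have pal i : (msize (p i ^+ al i) < (e + 2) * M)%N.
    apply: leq_trans (msizeX_lt (al i) (pe i)) _; rewrite mulnDl.
    by rewrite leq_add ?leq_mul // ?(ltnW (ltn_ord _)) // leq_pmulr.
  apply: leq_trans (msize_prod_lt pal) _; rewrite card_ord /K /c [leqRHS]mulnDl mulnA.
  by rewrite leq_add2l leq_pmulr.
pose A := \matrix_(s < #|{: {ffun 'I_d -> 'I_M}}|, t < #|{: 'X_{1..n < K}}|)
   (\prod_i p i ^+ (enum_val s : {ffun 'I_d -> 'I_M}) i)@_(enum_val t : 'X_{1..n < K}).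
have : kermx A != 0.
  rewrite kermx_eq0; apply/negP => /eqP A_free.
  have := rank_leq_col A; rewrite A_free leqNgt => /negP; apply.
  apply: leq_ltn_trans (card_bmultinom K) _; rewrite card_ffun !card_ord /K expnMn.
  apply: (@leq_trans (M * M ^ n)%N); first by rewrite ltn_mul2r expn_gt0 /= ltnSn.
  by rewrite -expnS leq_pexp2l.
case/matrix0Pn => r [s rs].
exists M, (fun al => kermx A r (enum_rank al)); split.
  by exists (enum_val s); rewrite enum_valK.
apply/mpolyP => m; rewrite mcoeff0 raddf_sum /=.
under eq_bigr => al _ do rewrite mcoeffZ.
have [mK|mK] := ltnP (mdeg m) K; last first.
  rewrite big1 // => al _; apply/eqP; rewrite mulf_eq0 mcoeff_eq0 orbC msize_mdeg_ge //.
  exact: leq_trans (ltnW (prod_lt al)) mK.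
have := congr1 (fun B : 'M_(_, _) => B r (enum_rank (BMultinom mK))) (mulmx_ker A).
rewrite !mxE => kerA; rewrite -[RHS]kerA [RHS](reindex (@enum_rank _)) /=; last first.
  exact/onW_bij/enum_rank_bij.
by apply: eq_bigr => al _; rewrite !mxE !enum_rankK.
Qed.

End AlgebraicDependence.

(** * Chains of sets with prime vanishing ideals in affine n-space *)

Section Chain.
Variables (F : fieldType) (n d : nat).
Variables (Z : nat -> ('I_n -> F) -> Prop) (phi : nat -> {mpoly F[n]}).
Hypothesis Z_prime : forall k, (k <= d)%N -> forall p q : {mpoly F[n]},
  (forall x, Z k x -> p.@[x] * q.@[x] = 0) ->
  (forall x, Z k x -> p.@[x] = 0) \/ (forall x, Z k x -> q.@[x] = 0).
Hypothesis Z_incr : forall k, (k < d)%N -> forall x, Z k x -> Z k.+1 x.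
Hypothesis phi0 : forall k, (k < d)%N -> forall x, Z k x -> (phi k).@[x] = 0.
Hypothesis phi1 : forall k, (k < d)%N -> exists2 x, Z k.+1 x & (phi k).@[x] != 0.
Hypothesis Z0 : exists x, Z 0%N x.

(* A relation between the [phi i], i <= k, on [Z k.+1] can be divided by the
   largest power of [phi k] occurring in all of its terms, and then restricted
   to [Z k], where [phi k] vanishes. *)
Lemma chain_independent (T : finType) (Q : T -> F) (al : T -> nat -> nat) k :
  (k <= d)%N -> forall A : {set T},
  {in A &, forall s t, (forall i, (i < k)%N -> al s i = al t i) -> s = t} ->
  (forall x, Z k x ->
    \sum_(t in A) Q t * \prod_(i < k) (phi i).@[x] ^+ al t i = 0) ->
  {in A, forall t, Q t = 0}.
Proof.
elim: k => [|k IH] kd A A_inj A0 t tA.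
  have [x Zx] := Z0; have := A0 x Zx; rewrite (bigD1 t) //= big_ord0 mulr1.
  rewrite big1 ?addr0 // => s /andP[sA /eqP[]]; exact: A_inj.
apply/eqP/negPn/negP => Qt.
(* Zero coefficients are dropped so that the minimal exponent [e] is attained by a term with nonzero
   coefficient, which contradicts the induction hypothesis. *)
pose A1 := [set s in A | Q s != 0].
have tA1 : t \in A1 by rewrite inE tA.
case: (arg_minnP (fun s => al s k) tA1) => s sA1 s_min.
set e := al s k in s_min.
pose G := \sum_(u in A1) Q u *: ((\prod_(i < k) phi i ^+ al u i) * phi k ^+ (al u k - e)).
have evalG x : G.@[x] = \sum_(u in A1) Q u *
    ((\prod_(i < k) (phi i).@[x] ^+ al u i) * (phi k).@[x] ^+ (al u k - e)).
  rewrite raddf_sum; apply: eq_bigr => u _; rewrite /= mevalZ mevalM rmorph_prod rmorphXn /=.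
  by congr (_ * (_ * _)); apply: eq_bigr => i _; rewrite rmorphXn.
have [x|phik0|G0] := @Z_prime k.+1 kd (phi k ^+ e) G.
- move=> Zx; rewrite evalG rmorphXn /= mulr_sumr -[RHS](A0 x Zx).
  rewrite [RHS](big_setID [set s | Q s != 0]) /= [X in _ = _ + X]big1 ?addr0.
    rewrite (_ : A :&: _ = A1); last by apply/finset.setP => u; rewrite !inE.
    apply: eq_bigr => u uA1; rewrite big_ord_recr /= -[in RHS](subnKC (s_min u uA1)) exprD.
    by rewrite mulrCA; congr (_ * _); rewrite mulrCA.
  by move=> u; rewrite !inE negbK => /andP[/eqP-> _]; rewrite mul0r.
- have [x Zx phix] := phi1 kd; have := phik0 x Zx; rewrite rmorphXn /= => /eqP.
  by rewrite expf_eq0 (negPf phix) andbF.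
pose A2 := [set u in A1 | al u k == e].
have sA2 : s \in A2 by apply/finset.setIdP.
have /finset.setIdP[_ /eqP[]] : s \in A1 by [].
apply: (IH (ltnW kd) A2) => //.
  move=> u v; rewrite !inE => /andP[/andP[uA _] /eqP uk] /andP[/andP[vA _] /eqP vk] uv.
  by apply: A_inj => // i; rewrite ltnS leq_eqVlt => /predU1P[->|/uv //]; rewrite uk vk.
move=> x Zx; rewrite -[RHS](G0 x (Z_incr kd Zx)) evalG.
rewrite [RHS](big_setID [set u | al u k == e]) /= [X in _ = _ + X]big1 ?addr0.
  rewrite (_ : A1 :&: _ = A2); last by apply/finset.setP => u; rewrite !inE.
  apply: eq_bigr => u /finset.setIdP[_ /eqP ->].
  by rewrite subnn mulr1.
move=> u /finset.setDP[uA1]; rewrite inE => uk.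
by rewrite phi0 // expr0n subn_eq0 leqNgt ltn_neqAle eq_sym uk s_min //= !mulr0.
Qed.

Lemma chain_length_le : (d <= n)%N.
Proof.
rewrite leqNgt; apply/negP => nd.
have [M [q [[al0 /eqP q0] q_dep]]] := algebraic_dependence (fun i : 'I_d => phi i) nd.
(* Exponents are extended by 0 from [d] on, as [chain_independent] indexes the functions by natural
   numbers. *)
case: q0; pose al (t : {ffun 'I_d -> 'I_M}) i : nat := if insub i is Some j then t j else 0%N.
have alE t (i : 'I_d) : al t i = t i by rewrite /al valK.
apply: (@chain_independent _ q al d (leqnn d) [set: _]); rewrite ?finset.in_setT //.
  by move=> s t _ _ st; apply/ffunP => i; apply/val_inj; rewrite /= -!alE st.
move=> x _; have := congr1 (meval x) q_dep; rewrite meval0 => qx.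
rewrite -[RHS]qx raddf_sum /=; apply: eq_big => [t|t _]; first by rewrite finset.in_setT.
rewrite /= mevalZ rmorph_prod /=.
by congr (_ * _); apply: eq_bigr => i _; rewrite rmorphXn alE.
Qed.

End Chain.

(** * Coordinates on the quotient torus *)

Section TorusDimension.
Variables (F : fieldType) (N : nat) (pi : 'S_N).
Local Notation I := ('I_N + 'I_N)%type.
Local Notation pt := {ffun I -> F}.
Variables (A : {set I}) (u0 : I).
Hypothesis u0A : u0 \in A.
Hypothesis trivially_actingE : forall g : pt,
  trivially_acting pi g <-> torus g /\ {in A &, forall u v, g u = g v}.
Local Notation n := #|A :\ u0|.

(** Coordinates on T: ratios within [A] are unchanged by the elements acting trivially, which are
    constant on [A]. *)
Definition slice (g : pt) (k : 'I_n) : F := g (enum_val k) / g u0.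

Definition normalize (g : pt) : pt := [ffun v => if v \in A then g v / g u0 else 1].

Lemma torus_normalize g : torus g -> torus (normalize g).
Proof.
move=> gT v; rewrite ffunE; case: ifP => _; last exact: oner_neq0.
by rewrite mulf_neq0 ?invr_eq0 ?gT.
Qed.

Lemma torus_torus_mul (g h : pt) : torus g -> torus h -> torus (torus_mul g h).
Proof. by move=> gT hT v; rewrite ffunE mulf_neq0 ?gT ?hT. Qed.

Lemma torus_cosetM (g k : pt) : torus g -> trivially_acting pi k ->
  torus_coset pi (torus_mul g k) = torus_coset pi g.
Proof.
move=> gT /trivially_actingE[kT kA]; apply/seteqP; split=> _ [h /trivially_actingE[hT hA] <-].
  exists (torus_mul k h); last by apply/ffunP => v; rewrite !ffunE mulrA.
  apply/trivially_actingE; split; first exact: torus_torus_mul.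
  by move=> u v uA vA; rewrite !ffunE (kA u v) ?(hA u v).
exists (torus_mul [ffun v => (k v)^-1] h).
  apply/trivially_actingE; split=> [v|u v uA vA].
    by rewrite !ffunE mulf_neq0 ?invr_eq0 ?kT ?hT.
  by rewrite !ffunE (kA u v) ?(hA u v).
by apply/ffunP => v; rewrite !ffunE mulrA mulfK ?kT.
Qed.

Lemma torus_coset_normalize g : torus g ->
  torus_coset pi (normalize g) = torus_coset pi g.
Proof.
move=> gT; pose k : pt := [ffun v => if v \in A then (g u0)^-1 else (g v)^-1].
have -> : normalize g = torus_mul g k.
  by apply/ffunP => v; rewrite !ffunE; case: ifP => // _; rewrite mulfV ?gT.
apply: torus_cosetM => //; apply/trivially_actingE; split=> [v|u v uA vA].
  by rewrite ffunE; case: ifP; rewrite invr_eq0 gT.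
by rewrite !ffunE uA vA.
Qed.

Lemma slice_coset (g h : pt) : torus g -> torus h ->
  torus_coset pi g = torus_coset pi h -> slice g = slice h.
Proof.
move=> gT hT gh; have : torus_coset pi g g.
  exists [ffun=> 1]; last by apply/ffunP => v; rewrite !ffunE mulr1.
  apply/trivially_actingE; split=> [v|u v _ _]; rewrite !ffunE //; exact: oner_neq0.
rewrite gh => -[k /trivially_actingE[kT kA] <-]; apply/funext => j.
rewrite /slice !ffunE (kA (enum_val j) u0) //; last first.
  by have := enum_valP j; rewrite !inE => /andP[].
by rewrite invfM mulrACA mulfV ?kT ?mulr1.
Qed.

Lemma slice_poly (P : {mpoly F[#|{: I}|]}) :
  exists p : {mpoly F[n]}, forall g, torus g -> p.@[slice g] = eval_at P (normalize g).
Proof.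
pose X v : {mpoly F[n]} := if [pick j : 'I_n | enum_val j == v] is Some j then 'X_j else 1.
exists (P \mPo [tuple X (enum_val k) | k < #|{: I}|]) => g gT.
rewrite comp_mpoly_meval /eval_at; apply: meval_eq => k; rewrite tnth_mktuple /X.
case: pickP => [j /eqP jk|none]; rewrite ffunE -?jk.
  by rewrite mevalXU; have := enum_valP j; rewrite !inE => /andP[_ ->].
rewrite meval1; case: ifP => // kA.
have [->|ku0] := eqVneq (enum_val k) u0; first by rewrite mulfV ?gT.
have kA' : enum_val k \in A :\ u0 by rewrite !inE ku0.
by have := none (enum_rank_in kA' (enum_val k)); rewrite enum_rankK_in ?eqxx.
Qed.

(** A power of the coordinate at [u0] clears the denominators, so polynomial conditions on [slice g]
    define closed sets of the torus. *)
Lemma homogenize (p : {mpoly F[n]}) :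
  exists (P : {mpoly F[#|{: I}|]}) D, forall g, torus g ->
    eval_at P g = g u0 ^+ D * p.@[slice g].
Proof.
pose X (v : I) : {mpoly F[#|{: I}|]} := 'X_(enum_rank v).
have evalX v g : (X v).@[fun k => g (enum_val k)] = g v by rewrite mevalXU enum_rankK.
elim/mpolyind: p => [|c m p _ _ [P [D PD]]].
  by exists 0, 0%N => g _; rewrite /eval_at !meval0 mulr0.
exists (c *: (\prod_j X (enum_val j) ^+ m j * X u0 ^+ D) + X u0 ^+ mdeg m * P).
exists (mdeg m + D)%N => g gT; have u0N0 : g u0 != 0 by apply: gT.
rewrite /eval_at !(mevalD, mevalZ, mevalM, rmorph_prod, rmorphXn) /= !evalX.
have -> : P.@[fun k => g (enum_val k)] = g u0 ^+ D * p.@[slice g] := PD g gT.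
rewrite mevalX exprD.
have -> : \prod_(i < n) (X (enum_val i) ^+ m i).@[fun k => g (enum_val k)] =
    g u0 ^+ mdeg m * \prod_(i < n) slice g i ^+ m i.
  rewrite mdegE -prodrXr -big_split /=; apply: eq_bigr => j _.
  by rewrite rmorphXn /= evalX -exprMn /slice mulrCA mulfV ?mulr1.
by ring.
Qed.

Local Open Scope classical_set_scope.

(** Irreducibility makes the vanishing ideals in [slice] coordinates prime, as zero sets there are
    closed in T. An equation of the k-th set that fails on the next one, evaluated at normalized
    representatives, becomes a polynomial in [slice]. *)
Lemma torus_chain_le d Z :
  irreducible_chain (quotient_torus_closed (F := F) pi) d Z -> (d <= n)%N.
Proof.
move=> [Z_irr Z_incr].
pose Zs k (x : 'I_n -> F) := exists2 g, torus g /\ Z k (torus_coset pi g) & x = slice g.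
have Z_coset k c : (k <= d)%N -> Z k c -> exists2 g, torus g & c = torus_coset pi g.
  by move=> /Z_irr[[Zc _] _ _] /Zc[g gT <-]; exists g.
have Z_ideal k : (k <= d)%N -> exists S, forall g, torus g ->
    (Z k (torus_coset pi g) <-> zeros S g).
  move=> /Z_irr[[_ [_ [S ->] ZE]] _ _]; exists S => g gT.
  suff -> : Z k (torus_coset pi g) <-> (torus (F := F) (N := N) `&` zeros S) g.
    by split=> // -[].
  by rewrite -ZE; split=> // -[].
have phi_ex k : exists p : {mpoly F[n]}, (k < d)%N ->
    (forall x, Zs k x -> p.@[x] = 0) /\ (exists2 x, Zs k.+1 x & p.@[x] != 0).
  case: (ltnP k d) => kd; last by exists 0.
  have [Zk Zk_ne] := Z_incr k kd.
  have [c Zc Zkc] : exists2 c, Z k.+1 c & ~ Z k c.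
    apply: contrapT => none; apply: Zk_ne; apply/seteqP; split=> // c Zc.
    by apply: contrapT => Zkc; apply: none; exists c.
  have [h hT cE] := Z_coset k.+1 c kd Zc; rewrite cE in Zc Zkc.
  have [S SE] := Z_ideal k (ltnW kd).
  have hnT := torus_normalize hT.
  have [P SP Ph] : exists2 P, S P & eval_at P (normalize h) != 0.
    apply: contrapT => none; apply: Zkc; rewrite -(torus_coset_normalize hT).
    apply/(SE _ hnT) => P SP; apply: contrapT => /eqP Ph; apply: none.
    by exists P.
  have [p pE] := slice_poly P; exists p => _; split.
    move=> _ [g [gT Zg] ->]; rewrite pE //.
    rewrite -(torus_coset_normalize gT) in Zg.
    by apply: ((SE _ (torus_normalize gT)).1 Zg).
  by exists (slice h); [exists h | rewrite pE].
have [phi phiP] := choice phi_ex.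
apply: (@chain_length_le F n d Zs phi).
- move=> k kd p q pq.
  pose Z_ (p : {mpoly F[n]}) := [set torus_coset pi g | g in [set g | torus g /\ p.@[slice g] = 0]].
  have Z_P r g : torus g -> Z_ r (torus_coset pi g) <-> r.@[slice g] = 0.
    move=> gT; split=> [[h [hT rh] hg]|rg]; first by rewrite -(slice_coset hT gT hg).
    by exists g.
  have Z_closed r : quotient_torus_closed pi (Z_ r).
    split; first by move=> _ [g [gT _] <-]; exists g.
    have [P [D PD]] := homogenize r.
    exists (zeros [set P]); first by exists [set P].
    apply/seteqP; split=> g [gT].
      move=> /(Z_P r g gT) rg; split=> // _ ->; by rewrite PD // rg mulr0.
    move=> gP; split=> //; apply/(Z_P r g gT); have /eqP := gP P erefl.
    by rewrite PD // mulf_eq0 expf_eq0 (negPf (gT u0)) andbF => /eqP.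
  have [_ _ Zk_irr] := Z_irr k kd.
  have [|Zp|Zq] := Zk_irr (Z_ p) (Z_ q) (Z_closed p) (Z_closed q).
  + move=> c Zc; have [g gT cE] := Z_coset k c kd Zc; rewrite cE in Zc *.
    have /eqP : p.@[slice g] * q.@[slice g] = 0 by apply: pq; exists g.
    by rewrite mulf_eq0 => /orP[] /eqP ?; [left|right]; apply/Z_P.
  + by left=> _ [g [gT Zg] ->]; apply/Z_P/Zp.
  + by right=> _ [g [gT Zg] ->]; apply/Z_P/Zq.
- by move=> k kd _ [g [gT Zg] ->]; exists g => //; split=> //; apply: (Z_incr k kd).1.
- by move=> k kd; case: (phiP k kd).
- by move=> k kd; case: (phiP k kd).
- have [_ [c Zc] _] := Z_irr 0%N isT.
  by have [g gT cE] := Z_coset 0%N c isT Zc; exists (slice g), g => //; rewrite -cE.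
Qed.

End TorusDimension.

(** * The dimension of Y_pi *)

Section ZariskiClosure.
Variables (F : numFieldType) (I : finType).
Local Notation pt := {ffun I -> F}.
Local Open Scope classical_set_scope.

Lemma zariski_closureE (X : set pt) :
  zariski_closure X = zeros [set p | forall y, X y -> eval_at p y = 0].
Proof.
apply/seteqP; split=> x Xx.
  apply: Xx; split; first by eexists.
  by move=> y Xy p; apply.
by move=> _ [[S ->] XS] p Sp; apply: Xx => y /XS; apply.
Qed.

Lemma sub_zariski_closure (X : set pt) : X `<=` zariski_closure X.
Proof. by move=> x Xx; rewrite zariski_closureE => p; apply. Qed.

Lemma zariski_closureS (X X' : set pt) :
  X `<=` X' -> zariski_closure X `<=` zariski_closure X'.
Proof.
by move=> XX' x; rewrite !zariski_closureE => Xx p pX'; apply: Xx => y /XX'; apply: pX'.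
Qed.

Lemma poly_cofinite_eq0 (p : {poly F}) (s : seq F) :
  (forall x, x \notin s -> p.[x] = 0) -> p = 0.
Proof.
move=> p0; pose q := p * \prod_(z <- s) ('X - z%:P).
have q0 x : q.[x] = 0.
  rewrite hornerM; have [xs|xs] := boolP (x \in s); last by rewrite p0 ?mul0r.
  by rewrite horner_prod (big_rem x) //= hornerXsubC subrr mul0r mulr0.
have : q = 0.
  apply/eqP/negPn/negP => qN0; pose r := [seq i%:R : F | i <- iota 0 (size q)].
  have : (size r < size q)%N; last by rewrite size_map size_iota ltnn.
  apply: max_poly_roots => //; first by apply/allP => x _; apply/rootP.
  by rewrite map_inj_uniq ?iota_uniq //; apply: mulrIn; apply: oner_neq0.
by move/eqP; rewrite mulf_eq0 (negPf (monic_neq0 (monic_prod_XsubC _ _ _))) orbF => /eqP.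
Qed.

Lemma eval_at_line (c : I -> {poly F}) (p : {mpoly F[#|I|]}) :
  exists P : {poly F}, forall s, P.[s] = eval_at p [ffun x => (c x).[s]].
Proof.
exists (mmap polyC (fun k => c (enum_val k)) p) => s.
rewrite /mmap horner_sum /eval_at mevalE; apply: eq_bigr => m _.
rewrite hornerM hornerC horner_prod; congr (_ * _).
by apply: eq_bigr => k _; rewrite horner_exp ffunE.
Qed.

(** The curves may have any degree: [entry] is quadratic in its parameters, so a line of parameters
    is mapped to a curve. *)
Definition line_connected (X : set pt) : Prop :=
  forall y z, X y -> X z -> exists c : I -> {poly F},
    [/\ forall s, X [ffun x => (c x).[s]], y = [ffun x => (c x).[0]]
      & z = [ffun x => (c x).[1]]].

(** Restrict two polynomials, nonzero at [y] and at [z] respectively, to a curve through both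
    points: their product is a nonzero polynomial in one variable. *)
Lemma line_connected_irreducible (Y X : set pt) :
  X `<=` Y -> X !=set0 -> line_connected X ->
  irreducible_closed (closed_in Y) (Y `&` zariski_closure X).
Proof.
move=> XY [x Xx] X_lines; split.
- exists (zariski_closure X) => //; rewrite zariski_closureE; by eexists.
- by exists x; split; [exact: XY | exact: sub_zariski_closure].
move=> _ _ [_ [S1 ->] ->] [_ [S2 ->] ->] cover.
have XS S : ~ (Y `&` zariski_closure X `<=` Y `&` zeros S) ->
    exists p, S p /\ exists2 y, X y & eval_at p y <> 0.
  move=> nsub; apply: contrapT => none; apply: nsub => y [Yy].
  rewrite zariski_closureE => Xy; split=> // p Sp; apply: Xy => z Xz.
  by apply: contrapT => pz; apply: none; exists p; split=> //; exists z.
apply: contrapT => /not_orP[/XS[p [Sp [y Xy py]]] /XS[q [Sq [z Xz qz]]]].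
have [c [cX yE zE]] := X_lines y z Xy Xz.
have [P PE] := eval_at_line c p; have [Q QE] := eval_at_line c q.
have : P * Q = 0.
  apply: (@poly_cofinite_eq0 _ [::]) => s _; rewrite hornerM PE QE.
  case: (cover [ffun x => (c x).[s]]) => [|[_ /(_ p Sp) ->]|[_ /(_ q Sq) ->]].
  - by split; [exact: XY | exact: sub_zariski_closure].
  - by rewrite mul0r.
  - by rewrite mulr0.
move=> /eqP; rewrite mulf_eq0 => /orP[] /eqP PQ0.
  by case: py; rewrite yE -PE PQ0 horner0.
by case: qz; rewrite zE -QE PQ0 horner0.
Qed.

End ZariskiClosure.

(** * Points of the matrix Schubert variety from triangular parameters *)

Section Parametrization.
Variables (N : nat) (pi : 'S_N).
Local Notation box := ('I_N * 'I_N)%type.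

Section Entry.
Variables (R : comNzRingType).

(** A box outside D(pi) is at or below the one of its column, where its parameter goes into P, or
    above that one and right of the one of its row, where it goes into Q. So each such box carries
    exactly one parameter. *)
Definition unipotent_entry (t : box -> R) (c b : 'I_N) : R :=
  if c == b then 1 else if (c < b)%N && (pi c < pi b)%N then t (pi c, b) else 0.

(* The entries of P pi Q, where P is the lower triangular matrix whose entry
   (a, pi c) is [t (a, c)] and Q = [unipotent_entry t]. *)
Definition entry (t : box -> R) (x : box) : R :=
  \sum_(c | (pi c <= x.1)%N) t (x.1, c) * unipotent_entry t c x.2.

End Entry.

Variable F : numFieldType.

Lemma horner_entry (t : box -> {poly F}) s x :
  (entry t x).[s] = entry (fun y => (t y).[s]) x.
Proof.
rewrite horner_sum; apply: eq_bigr => c _; rewrite hornerM /unipotent_entry.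
by case: ifP => _; [rewrite hornerC | case: ifP; rewrite ?hornerC].
Qed.

(** P may be singular, but P + s is invertible for all but finitely many s, and a polynomial in s
    vanishing for those s vanishes at 0. *)
Lemma entry_schubert (t : box -> F) :
  matrix_schubert pi [ffun x => entry t x].
Proof.
pose P : 'M[F]_N := \matrix_(a, r) if (r <= a)%N then t (a, (pi^-1)%g r) else 0.
pose Q : 'M[F]_N := \matrix_(c, b) unipotent_entry t c b.
have Q_trig : is_trig_mx Q^T.
  apply/is_trig_mxP => b c bc; rewrite !mxE /unipotent_entry.
  by rewrite -val_eqE gtn_eqF //= ltnNge (ltnW bc).
have Q_unit : Q \in unitmx.
  rewrite unitmxE -det_tr (det_trig Q_trig) big1 ?unitr1 // => b _.
  by rewrite !mxE /unipotent_entry eqxx.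
have entryE (A : 'M[F]_N) (a b : 'I_N) : (A *m schubert_perm_mx F pi *m Q) a b =
    \sum_c A a (pi c) * unipotent_entry t c b.
  rewrite mxE; apply: eq_bigr => c _; rewrite ?mxE; congr (_ * _).
  rewrite (bigD1 (pi c)) //= !mxE eqxx mulr1 big1 ?addr0 // => r /negPf rc.
  by rewrite !mxE eq_sym rc mulr0.
rewrite /matrix_schubert zariski_closureE => p p0.
(* Row a of pi Q is row pi^-1(a) of Q, so these are the entries of (P + s) pi Q. *)
pose c (x : box) : {poly F} := (entry t x)%:P + (unipotent_entry t ((pi^-1)%g x.1) x.2) *: 'X.
have [R RE] := eval_at_line c p.
have -> : [ffun x => entry t x] = [ffun x => (c x).[0]].
  by apply/ffunP => x; rewrite !ffunE !hornerE.
rewrite -RE (@poly_cofinite_eq0 _ R [seq - t (pi b, b) | b <- enum 'I_N]) ?horner0 //.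
move=> s s_notin; rewrite RE; apply: p0; exists (P + s%:M), Q.
have Ps_trig : is_trig_mx (P + s%:M).
  apply/is_trig_mxP => a r ar; rewrite !mxE leqNgt ar -val_eqE ltn_eqF //=.
  by rewrite mulr0n addr0.
split=> //.
  rewrite unitmxE (det_trig Ps_trig) unitfE; apply/prodf_neq0 => a _.
  rewrite !mxE leqnn eqxx mulr1n; apply: contra s_notin; rewrite addrC addr_eq0 => /eqP ->.
  by apply/mapP; exists ((pi^-1)%g a); rewrite ?mem_enum // permKV.
apply/ffunP => x; rewrite !ffunE entryE !hornerE.
under [RHS]eq_bigr => b _ do rewrite !mxE mulrDl permK.
rewrite big_split /=; congr (_ + _).
  rewrite /entry big_mkcond; apply: eq_bigr => b _.
  by case: ifP => // _; rewrite mul0r.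
rewrite (bigD1 ((pi^-1)%g x.1)) //= permKV eqxx mulr1n mulrC big1 ?addr0 // => b bx.
suff /negPf -> : x.1 != pi b by rewrite mul0r.
by apply: contraNneq bx => ->; rewrite permK.
Qed.

End Parametrization.

(** * The order in which the parameters are switched on *)

Section Dimension.
Variables (F : numFieldType) (N : nat) (pi : 'S_N).
Local Notation box := ('I_N * 'I_N)%type.
Local Notation D := (rothe pi).
Local Notation L := (Lset pi).
Local Notation L' := (L :\: D).

Definition is_one (x : box) : bool := x.1 == pi x.2.

(* Switching on the parameters of [entry] at the boxes of L(pi) \ D(pi) by
   increasing [key], the entry at a box vanishes until its own turn. *)
Definition key (x : box) : nat :=
  if is_one x then 0 else if (x.1 < pi x.2)%N then 1 else (2 + (N - x.2))%N.

Definition free_boxes : seq box := sort (fun x y => key x <= key y)%N (enum L').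

Lemma mem_free_boxes x : (x \in free_boxes) = (x \in L').
Proof. by rewrite mem_sort mem_enum. Qed.

Lemma size_free_boxes : size free_boxes = #|L'|.
Proof. by rewrite size_sort cardE. Qed.

Definition stage (k : nat) : pred box :=
  fun x => is_one x && (x \notin L') || (x \in take k free_boxes).

Lemma nth_key z i j : (i <= j)%N -> (j < size free_boxes)%N ->
  (key (nth z free_boxes i) <= key (nth z free_boxes j))%N.
Proof.
move=> ij js; apply: (@sorted_leq_nth _ (fun x y => key x <= key y)%N) => //.
- by move=> y x w; apply: leq_trans.
- by apply: sort_sorted => x y; apply: leq_total.
- by rewrite inE (leq_ltn_trans ij).
Qed.

Lemma stage_key k x z : (k < size free_boxes)%N -> x = nth z free_boxes k ->
  forall y, stage k y -> y != x /\ (key y <= key x)%N.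
Proof.
move=> kx xE y /orP[/andP[y1 yL']|].
  split; last by rewrite /key y1.
  by apply: contraNneq yL' => ->; rewrite -mem_free_boxes xE mem_nth.
move=> /(nthP z)[j]; rewrite size_takel ?(ltnW kx) // => jk; rewrite nth_take // => <-.
rewrite xE; split; last by apply: nth_key; rewrite // ltnW.
by rewrite nth_uniq ?sort_uniq ?enum_uniq ?(ltn_trans jk) // ltn_eqF.
Qed.

Lemma one_stage k x z : (k < size free_boxes)%N -> x = nth z free_boxes k ->
  ~~ is_one x -> forall y, is_one y -> stage k.+1 y.
Proof.
move=> kx xE x1 y y1; rewrite /stage y1; have [yL'|//] := boolP (y \in L').
rewrite -mem_free_boxes in yL'; have /(nthP z)[j js yE] := yL'.
have jk : (j < k.+1)%N.
  rewrite ltnS leqNgt; apply/negP => kj; have := nth_key z (ltnW kj) js.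
  rewrite -xE yE [key y]/key y1 leqNgt => /negP; apply.
  by rewrite /key (negPf x1); case: ifP.
by rewrite -yE -(nth_take z jk) mem_nth // size_takel.
Qed.

(** A term not containing the parameter at [x] has a parameter of P at some (x.1, c) strictly below
    the one of column c, with c < x.2. Its key exceeds that of [x]: this is why the boxes below ones
    come last, from right to left. *)
Lemma entry_before k x z (t : box -> F) :
  (k < size free_boxes)%N -> x = nth z free_boxes k ->
  (forall y, ~~ stage k y -> t y = 0) -> entry pi t x = 0.
Proof.
move=> kx xE t0; have x_key := stage_key kx xE.
have tx : t x = 0.
  by apply: t0; apply/negP => /x_key[]; rewrite eqxx.
rewrite /entry big1 // => c cx; rewrite /unipotent_entry.
case: eqVneq => [->|cb]; first by rewrite -surjective_pairing tx mul0r.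
case: ifP => [/andP[cx2 pc]|_]; last by rewrite mulr0.
have [pcx|pcx] := eqVneq (pi c) x.1; first by rewrite pcx -surjective_pairing tx mulr0.
rewrite t0 ?mul0r //; apply/negP => /x_key[_]; apply/negP; rewrite -ltnNge /key /is_one /=.
rewrite [x.1 == pi c]eq_sym (negPf pcx) [(x.1 < pi c)%N]ltnNge cx /=.
case: ifP => // _; case: ifP => // _; have := ltn_ord x.2; lia.
Qed.

(** Only the parameters at [x] and at the one of its row are set to 1. The entry is the parameter at
    [x] if that belongs to P, and the product of both if it belongs to Q. *)
Lemma entry_after k x z : (k < size free_boxes)%N -> x = nth z free_boxes k ->
  exists t : {ffun box -> F}, (forall y, ~~ stage k.+1 y -> t y = 0) /\ entry pi t x != 0.
Proof.
move=> kx xE; have xL' : x \in L' by rewrite -mem_free_boxes xE mem_nth.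
pose a' := (pi^-1)%g x.1; have pa' : pi a' = x.1 by rewrite permKV.
pose t : {ffun box -> F} := [ffun y => ((y == x) || (y == (x.1, a')))%:R].
exists t; split=> [y|].
  have x_stage : stage k.+1 x by rewrite /stage (take_nth z) // -xE mem_rcons mem_head orbT.
  rewrite ffunE; case: eqVneq => [->|yx] /=; first by rewrite x_stage.
  case: eqVneq => //= yE; rewrite (one_stage kx xE) ?yE /is_one /= ?pa' //.
  apply: contra_neqN yx => /eqP x1; rewrite yE /a' x1 permK -x1.
  exact/esym/surjective_pairing.
suff -> : entry pi t x = 1 by exact: oner_neq0.
  rewrite /entry.
  have ax c : (x.1, c) == x = (c == x.2).
    by rewrite {2}[x]surjective_pairing xpair_eqE eqxx.
  have [ba'|ba'] := eqVneq x.2 a'.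
    rewrite (bigD1 a') ?pa' ?leqnn //= ffunE eqxx orbT /unipotent_entry ba' eqxx mulr1.
    rewrite big1 ?addr0 // => c /andP[_ ca'].
    by rewrite ffunE ax ba' xpair_eqE eqxx (negPf ca') mul0r.
  have [px|px|px] := ltngtP (pi x.2) x.1.
  - rewrite (bigD1 x.2) /= ?(ltnW px) // ffunE ax eqxx /unipotent_entry eqxx mulr1.
    rewrite big1 ?addr0 // => c /andP[_ cx].
    rewrite ffunE ax xpair_eqE eqxx (negPf cx) /=.
    have [->|_] := eqVneq c a'; last by rewrite mul0r.
    by rewrite pa' [(x.1 < _)%N]ltnNge (ltnW px) andbF mulr0.
  - have a'b : (a' < x.2)%N.
      move: xL'; rewrite !inE mem_rothe px /= -leqNgt => /andP[].
      by rewrite leq_eqVlt (negPf (_ : a' != x.2 :> nat)) // eq_sym.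
    rewrite (bigD1 a') /= ?pa' ?leqnn // ffunE eqxx orbT mul1r /unipotent_entry.
    rewrite eq_sym (negPf ba') a'b pa' px ffunE -surjective_pairing eqxx.
    rewrite big1 ?addr0 // => c /andP[pc ca'].
    rewrite ffunE ax xpair_eqE eqxx (negPf ca') orbF.
    have [cx|_] := eqVneq c x.2; last by rewrite mul0r.
    by move: pc; rewrite cx leqNgt px.
  - by case/eqP: ba'; apply: (perm_inj (s := pi)); rewrite pa'; apply/val_inj.
Qed.

(** The entry is a natural number with a positive term: from the one of the column of [x] if [x] is
    at or below it, otherwise from a one north-west of [x]. *)
Lemma entry1_neq0 x : x \in L -> entry pi (fun=> 1 : F) x != 0.
Proof.
rewrite Lset_above_one => /andP[_ /existsP[c /andP[/= c1 c2]]].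
have uE c' b : unipotent_entry pi (fun=> 1 : F) c' b =
    ((c' == b) || (c' < b)%N && (pi c' < pi b)%N)%:R.
  by rewrite /unipotent_entry; case: eqP => //= _; case: ifP.
rewrite /entry; under eq_bigr => c' _ do rewrite mul1r uE.
rewrite -natr_sum pnatr_eq0 -lt0n.
have [px|px] := leqP (pi x.2) x.1.
  by rewrite (bigD1 x.2) //= eqxx addSn.
rewrite (bigD1 c) //=; suff -> : (c == x.2) || (c < x.2)%N && (pi c < pi x.2)%N by rewrite addSn.
have [//|cx] := eqVneq c x.2; rewrite ltn_neqAle c2 (leq_ltn_trans c1 px) andbT /=.
by rewrite andbT; apply: contraNneq cx => /val_inj ->.
Qed.

End Dimension.

(** * Comparison of the dimensions of T and Y_pi *)

Section Toric.
Variables (F : numFieldType) (N : nat) (pi : 'S_N).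
Local Notation box := ('I_N * 'I_N)%type.
Local Notation D := (rothe pi).
Local Notation L := (Lset pi).
Local Notation L' := (L :\: D).

Definition Y_point (t : box -> F) : {ffun Lbox pi -> F} :=
  [ffun x => entry pi t (val x)].

Lemma Yvar_Y_point t : Yvar (Y_point t).
Proof.
exists [ffun x => entry pi t x]; first exact: entry_schubert.
by apply/ffunP => x; rewrite !ffunE.
Qed.

Section Chain.
Local Open Scope classical_set_scope.

Definition stage_image (k : nat) : set {ffun Lbox pi -> F} :=
  [set Y_point t | t in [set t : box -> F | forall y, ~~ stage pi k y -> t y = 0]].

Lemma stage_image_line_connected k : line_connected (stage_image k).
Proof.
move=> _ _ [t1 t1k <-] [t2 t2k <-].
pose t y : {poly F} := (t1 y)%:P + (t2 y - t1 y) *: 'X.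
have tE s : [ffun x : Lbox pi => (entry pi t (val x)).[s]] =
    Y_point (fun y => t1 y + (t2 y - t1 y) * s).
  apply/ffunP => x; rewrite !ffunE horner_entry; congr (entry pi _ _).
  by apply/funext => y; rewrite /t !hornerE.
exists (fun x => entry pi t (val x)); split=> [s||]; rewrite tE.
- by exists (fun y => t1 y + (t2 y - t1 y) * s) => // y yk; rewrite t1k ?t2k // subrr mul0r addr0.
- by congr Y_point; apply/funext => y; rewrite mulr0 addr0.
- by congr Y_point; apply/funext => y; rewrite mulr1 addrC subrK.
Qed.

(** The coordinate at the box switched on next vanishes on one closure and not on the following
    one. *)
Lemma Yvar_chain :
  exists Z, irreducible_chain (closed_in (@Yvar F N pi)) #|L'| Z.
Proof.
exists (fun k => @Yvar F N pi `&` zariski_closure (stage_image k)).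
have image_Y k : stage_image k `<=` @Yvar F N pi by move=> _ [t _ <-]; apply: Yvar_Y_point.
split=> [k _|k]; first apply: line_connected_irreducible => //.
- by exists (Y_point (fun=> 0)), (fun=> 0).
- exact: stage_image_line_connected.
rewrite -size_free_boxes => ks.
have [z _] : exists z : box, true by case: free_boxes ks => // z; exists z.
pose x := nth z (free_boxes pi) k.
have xL : x \in L.
  have : x \in L' by rewrite -mem_free_boxes mem_nth.
  by rewrite inE => /andP[].
split.
  apply: setIS; apply: zariski_closureS => _ [t tk <-]; exists t => // y yk.
  apply: tk; apply: contra yk; rewrite /stage (take_nth z ks) mem_rcons inE orbCA => ->.
  by rewrite orbT.
have [t [t_stage tx]] := entry_after F ks (erefl x).
move=> /seteqP[_ /(_ (Y_point t))[]].
  split; first exact: Yvar_Y_point.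
  by apply: sub_zariski_closure; exists t.
move=> _; rewrite zariski_closureE => /(_ 'X_(enum_rank (exist _ x xL : Lbox pi))).
rewrite /eval_at mevalXU enum_rankK ffunE /= => t0; case/eqP: tx; apply: t0.
move=> _ [t' t'_stage <-]; rewrite mevalXU enum_rankK ffunE /=.
exact: entry_before ks (erefl x) t'_stage.
Qed.

End Chain.

Hypothesis L_connected : side_connected L.

(** The point with all parameters 1 has no zero coordinate, so an element fixing it agrees on the
    row and the column of every box of L. *)
Lemma trivially_actingE (g : {ffun 'I_N + 'I_N -> F}) :
  trivially_acting pi g <-> torus g /\ {in Lvertices pi &, forall u v, g u = g v}.
Proof.
split=> [[gT g_triv]|[gT gA]].
  split=> //; apply: Lset_const => // x xL.
  have /ffunP/(_ (exist _ x xL)) := g_triv _ (Yvar_Y_point (fun=> 1)).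
  rewrite !ffunE /= => gx; apply: (divIf (gT (inr x.2))).
  apply: (mulIf (entry1_neq0 F xL)).
  by rewrite mulfV ?gT // mul1r -[RHS]gx mulrAC.
split=> // y _; apply/ffunP => -[[a b] abL]; rewrite ffunE /=.
rewrite (gA (inl a) (inr b)) ?(Lvertices_row abL) ?(Lvertices_col abL) //.
by rewrite mulrAC mulfV ?gT ?mul1r.
Qed.

(** With d the common dimension, the chain in Y_pi gives |L \ D(pi)| <= d and a chain of length d in
    T gives d <= m + n - 1. A box of L supplies the vertex [u0]. *)
Lemma toric_card : L != finset.set0 -> toric F pi ->
  (#|L'| < #|Lrow pi| + #|Lcol pi|)%N.
Proof.
move=> /finset.set0Pn[x xL] [d [[[Z Z_chain] _] [_ Y_max]]].
have xA : inl x.1 \in Lvertices pi.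
  by apply: (@Lvertices_row _ _ x.1 x.2); rewrite -surjective_pairing.
have := torus_chain_le xA trivially_actingE Z_chain.
rewrite -(card_Lvertices pi) [in X in _ -> X](cardsD1 (inl x.1)) xA add1n ltnS.
apply: leq_trans; rewrite leqNgt; apply/negP => dL.
have [Z' [Z'_irr Z'_incr]] := Yvar_chain.
apply: Y_max; exists Z'; split=> k kd; [apply: Z'_irr|apply: Z'_incr];
  exact: leq_trans dL.
Qed.

End Toric.

Theorem proposition4p8 (R : realType) (N : nat) (pi : 'S_N)
  (pi_toric : toric R[i] pi)
  (L_connected : side_connected (Lset pi))
  (three_ess : (3 <= #|essential pi :&: Lset pi|)%N) :
  let G := @Lgraph N pi in
  let U1 : {set Lrow pi + Lcol pi} := part true in
  let U2 : {set Lrow pi + Lcol pi} := part false in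
  [/\ (* (1) *)
      forall (i : Lrow pi) (j : Lcol pi),
        first_independent G (U1 :\ inl i) ->
        first_independent G (U2 :\ inr j) ->
        independent_face G [tuple U1 :\ inl i; U2 :\ inr j],
      (* (2) *)
      forall C C' : {set Lrow pi + Lcol pi},
        two_sided C -> first_independent G C ->
        two_sided C' -> first_independent G C' ->
        C <> C' ->
        independent_face G [tuple C; C'],
      (* (3) *)
      forall i i' : Lrow pi,
        i <> i' ->
        first_independent G (U1 :\ inl i) ->
        first_independent G (U1 :\ inl i') ->
        (~ independent_face G [tuple U1 :\ inl i; U1 :\ inl i'] <->
         exists C2 : {set Lrow pi + Lcol pi},
           [/\ C2 \proper U2, (#|C2| + 2 <= #|U2|)%N,
               two_sided ((U1 :\: [set inl i; inl i']) :|: C2)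
             & first_independent G ((U1 :\: [set inl i; inl i']) :|: C2)])
    & (* (4) *)
      forall (i : Lrow pi) (C : {set Lrow pi + Lcol pi}),
        first_independent G (U1 :\ inl i) ->
        two_sided C -> first_independent G C ->
        (~ independent_face G [tuple U1 :\ inl i; C] <->
         C :&: U1 = [set inl i] \/
         exists C' : {set Lrow pi + Lcol pi},
           [/\ two_sided C', first_independent G C',
               C' :&: U1 \subset C :&: U1
             & (C :&: U1) :\: (C' :&: U1) = [set inl i]])].
Proof.
move=> G U1 U2.
have L0 : Lset pi != finset.set0.
  have /card_gt0P[x /finset.setIP[_ xL]] := leq_trans (isT : 0 < 3)%N three_ess.
  by apply/finset.set0Pn; exists x.
have L_small := toric_card L_connected L0 pi_toric.
have [r1 [r2 [r3 [c1 [c2 [r12 [r31 r32] c12 r_full c_full]]]]]] :=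
  Lset_ferrers L_connected L_small three_ess.
have r1_full b : G r1 b by case: (r_full b).
have r2_full b : G r2 b by case: (r_full b).
have c1_full a : G a c1 by case: (c_full a).
have c2_full a : G a c2 by case: (c_full a).
split.
- by move=> i j; apply: (independent_face_opposite_sides r12 c12 r1_full r2_full c1_full c2_full).
- move=> C C' C2 Cf C'2 C'f; apply: (independent_face_gap_gap r1_full c1_full) => //.
  + exact: (Lgraph_nested L_connected L_small).
  + exact: two_sided_gap C2 Cf.
  + exact: two_sided_gap C'2 C'f.
- move=> i i'; exact: (same_side_faces r12 c12 r1_full r2_full c1_full c2_full r31 r32).
- move=> i C; exact: (row_gap_faces r12 c12 r1_full r2_full c1_full c2_full).
Qed.
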